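(* Let $d\ge 2$ and $q\ge 2$ be integers and let $Q:\mathbb{Z}_q\to(0,\infty)$ be a strictly positive even function with $Q(0)=1$. Set $\gamma:=\Vert Q\Vert_{\frac{d+1}{2},\mathbb{Z}_q}$ and $\delta:=\Vert Q\Vert_{d+1,\mathbb{Z}_q\setminus\{0\}}$. If $(\gamma,\delta)\in G_d$, then there exists a family $(\mu_i)_{i\in\mathbb{Z}_q}$ of pairwise distinct tree-automorphism invariant Gibbs measures for the $\mathbb{Z}_q$-valued (clock) model with transfer operator $Q$ on the Cayley tree $\Gamma^d$, which are equivalent under joint translation of the local spin spaces (i.e. $\mu_j$ is the image of $\mu_i$ under $(\sigma_x)_{x\in V}\mapsto(\sigma_x+j-i)_{x\in V}$ for all $i,j\in\mathbb{Z}_q$). Moreover, for every $i\in\mathbb{Z}_q$ the single-site marginal of $\mu_i$ at a vertex $0\in V$ satisfies $$\left(\delta\,\frac{1-\delta\,\varepsilon(\gamma,\delta)^d}{1+\gamma\,\varepsilon(\gamma,\delta)^{d-1}}\right)^{d+1}\le\frac{\mu_i(\sigma_0\neq i)}{\mu_i(\sigma_0=i)}\le\left(\delta\,\frac{1+\delta\,\varepsilon(\gamma,\delta)^d}{1-\gamma\,\varepsilon(\gamma,\delta)^{d-1}}\right)^{d+1},$$ where $\varepsilon(\gamma,\delta)$ denotes the smallest positive solution of the equation $\varepsilon=\gamma\varepsilon^d+\delta$.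
   Context: $\mathbb{Z}_q=\mathbb{Z}/q\mathbb{Z}$. The Cayley tree $\Gamma^d=(V,L)$ of order $d$ is the infinite connected graph without cycles in which every vertex has exactly $d+1$ neighbours. For $\Lambda\subset V$, $\partial\Lambda$ is its outer boundary. The configuration space is $\mathbb{Z}_q^V$ with coordinate maps $\sigma_x$. A Gibbs measure for $Q$ is a probability measure $\mu$ on $\mathbb{Z}_q^V$ with $\mu\gamma_\Lambda=\mu$ for all finite $\Lambda\subset V$, where $$\gamma_\Lambda(\sigma_\Lambda=\omega_\Lambda\mid\omega)=Z_\Lambda(\omega_{\partial\Lambda})^{-1}\prod_{\{x,y\}\in L,\ \{x,y\}\cap\Lambda\ne\emptyset}Q(\omega_x-\omega_y).$$ Norms: $\Vert x\Vert_{p,S}=\big(\sum_{j\in S}|x(j)|^p\big)^{1/p}$. Good set: $G_d:=\{(\gamma,\delta)\in(1,\infty)\times(0,\infty)\mid\exists\,\varepsilon>0:\ \delta+\gamma\varepsilon^d\le\varepsilon\ \text{ and }\ 2d\gamma\varepsilon^{d-1}+2d\delta\varepsilon^d<1\}$. *)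

(* Defs.v *)
From HB Require Import structures.
From mathcomp Require Import all_boot all_order all_algebra finmap.
From mathcomp Require Import all_classical all_reals all_analysis.

Set Implicit Arguments.
Unset Strict Implicit.
Unset Printing Implicit Defensive.

Import Order.TTheory GRing.Theory Num.Theory.

Local Open Scope classical_set_scope.
Local Open Scope fset_scope.
Local Open Scope ring_scope.

(* The graph (V, adj) is a Cayley tree of order d.  This determines it up to
   isomorphism.  Acyclicity excludes simple cycles with at least three
   vertices, since [:: x; y] is a [cycle] as soon as x and y are adjacent. *)
Definition cayley_tree (d : nat) (V : choiceType) (adj : rel V) : Prop :=
  [/\ symmetric adj /\ irreflexive adj,
      infinite_set [set: V],
      forall x y, exists2 p, path adj x p & last x p = y,
      forall p : seq V, (2 < size p)%N -> ~~ ucycleb adj p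
    & forall x, exists2 N : {fset V}, N =i adj x & #|` N| = d.+1 ].

Definition graph_automorphism (V : choiceType) (adj : rel V) (phi : V -> V) :=
  bijective phi /\ forall x y, adj (phi x) (phi y) = adj x y.

Definition edges (V : choiceType) (adj : rel V) : set {fset V} :=
  [set e | exists2 p : V * V, adj p.1 p.2 & e = [fset p.1; p.2]].

(* Measurable types are pointed. *)
HB.instance Definition _ (n : nat) := isPointed.Build 'I_n.+1 ord0.

Definition cylinders (V : choiceType) (q : nat) : set (set (V -> 'Z_q)) :=
  [set C | exists x a, C = [set s | s x = a]].

(* Configurations V -> 'Z_q, carrying the product sigma-algebra. *)
Notation config V q := (g_sigma_algebraType (@cylinders V q)).

Section Specification.
Variables (R : realType) (V : choiceType) (adj : rel V) (q : nat).
Variable Q : 'Z_q -> R.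

(* The orientation of e chosen by its enumeration is immaterial when Q is
   even, see [edge_weightE]. *)
Definition edge_weight (w : config V q) (e : {fset V}) : R :=
  if enum_fset e is [:: x; y] then Q (w x - w y) else 1.

Lemma edge_weightE (w : config V q) (x y : V) :
  (forall j : 'Z_q, Q (- j) = Q j) -> x != y ->
  edge_weight w [fset x; y] = Q (w x - w y).
Proof.
move=> Qeven xy; rewrite /edge_weight.
have : perm_eq (enum_fset [fset x; y]) [:: x; y].
  apply: uniq_perm; rewrite ?fset_uniq //= ?inE ?xy // => z.
  by rewrite !inE.
case: (enum_fset _) => [|a [|b [|c s]]] ps; have := perm_size ps => //= _.
have := perm_mem ps x; rewrite !inE eqxx /= => /orP[]/eqP e.
  have := perm_mem ps y; rewrite !inE eqxx orbT -e eq_sym (negbTE xy) /=.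
  by move/eqP ->.
have := perm_mem ps y; rewrite !inE eqxx orbT -e (eq_sym y x) (negbTE xy) orbF.
by move/eqP => <-; rewrite -opprB Qeven.
Qed.

Definition boltzmann_weight (L : {fset V}) (w : config V q) : R :=
  \big[*%R/1]_(e \in edges adj `&` [set e | e `&` L != fset0])
    edge_weight w e.

(* The configuration equal to s on L and to w off L. *)
Definition glue_config (L : {fset V}) (s : {ffun L -> 'Z_q}) (w : config V q)
  : config V q := fun x => if insub x is Some u then s u else w x.

Definition partition_function (L : {fset V}) (w : config V q) : R :=
  \sum_(s : {ffun L -> 'Z_q}) boltzmann_weight L (glue_config s w).

(* gibbs_kernel L w A is gamma_L(A | w). *)
Definition gibbs_kernel (L : {fset V}) (w : config V q)
    (A : set (config V q)) : R :=
  \sum_(s : {ffun L -> 'Z_q})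
    (partition_function L w)^-1 * boltzmann_weight L (glue_config s w) *
    \1_A (glue_config s w).

Definition gibbs_measure (mu : probability (config V q) R) : Prop :=
  forall (L : {fset V}) (A : set (config V q)), measurable A ->
    (\int[mu]_w (gibbs_kernel L w A)%:E = mu A)%E.

End Specification.

(* A term of type [probability _ _] is a function on all sets, whose values
   off the sigma-algebra are irrelevant: hence this form of equality. *)
Definition same_measure d (T : measurableType d) (R : realType)
    (mu nu : set T -> \bar R) : Prop :=
  forall A, measurable A -> mu A = nu A.

Definition automorphism_invariant (R : realType) (V : choiceType)
    (adj : rel V) (q : nat) (mu : probability (config V q) R) : Prop :=
  forall phi, graph_automorphism adj phi ->
    same_measure (pushforward mu (fun s : config V q => s \o phi : config V q))
               mu.

Definition translate (V : choiceType) (q : nat) (k : 'Z_q) (s : config V q)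
  : config V q := fun x => s x + k.

Definition lpnorm (R : realType) (q : nat) (p : R) (S : {pred 'Z_q})
    (x : 'Z_q -> R) : R :=
  (\sum_(j in S) `|x j| `^ p) `^ p^-1.

Definition good_set (R : realType) (d : nat) : set (R * R) :=
  [set gd | [/\ 1 < gd.1, 0 < gd.2 & exists eps : R,
     [/\ 0 < eps, gd.2 + gd.1 * eps ^+ d <= eps
       & 2 * d%:R * gd.1 * eps ^+ d.-1 + 2 * d%:R * gd.2 * eps ^+ d < 1]]].

Definition smallest_positive_solution (R : realType) (d : nat)
    (gamma delta eps : R) : Prop :=
  let sol e := 0 < e /\ e = gamma * e ^+ d + delta in
  sol eps /\ forall e, sol e -> eps <= e.

(* Main.v *)
From HB Require Import structures.
Require Import Defs.
From mathcomp Require Import all_boot all_order all_algebra finmap.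
From mathcomp Require Import all_classical all_reals all_analysis.
From mathcomp Require Import measurable_realfun ring lra.

Set Implicit Arguments.
Unset Strict Implicit.
Unset Printing Implicit Defensive.

Import Order.TTheory GRing.Theory Num.Theory.
Import numFieldNormedType.Exports.

Local Open Scope classical_set_scope.
Local Open Scope ring_scope.

(** The measures are tree-indexed Markov chains given by a boundary law.
    Suppose that [u] is positive, [u 0 = 1] and
      [\sum_j Q (i - j) * u j ^+ d = c * u i]  for all [i].
    Putting the weight [u ^+ d] on the vertices next to a finite subtree [S] and
    summing them out gives every configuration on [S] a weight
    ([tree_weight]): the product of the edge factors [Q] and of one factor [u]
    for each edge leaving [S].  The equation for [u] says that these weights
    are consistent when a leaf is attached ([tree_weight_marginal]), so that
    after normalisation they are the finite-dimensional laws of a measure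
    ([tree_measure]).  That measure is a Gibbs measure
    ([gibbs_tree_measure]): when [S] contains [L] and its neighbours, no factor
    [u] is left on [L], and what remains there is the Boltzmann weight
    ([tree_weight_split]).  The weights do not refer to a root, which makes the
    measure invariant under automorphisms, and replacing [u] by its translate
    by [i] translates the measure.

    A boundary law concentrated near the state [0] is a fixed point of a map on
    functions [f] on the nonzero spins (the values of [u] off [0]).  For the norm
    of exponent [d + 1], the inequalities of Young and Hoelder show that this
    map sends the ball of radius [eps] into itself, where
    [eps = gamma * eps ^+ d + delta], and that it is a contraction there
    ([boundary_law_exists]).  The norm [nu] of the fixed point is at most
    [eps < 1], so that [u j < u 0] for [j != 0] and the translates are
    different measures.  The single-site law at a vertex is proportional to
    [u ^+ d.+1], the ratio in the statement is therefore [nu ^+ d.+1], and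
    inserting [nu <= eps] once more in the fixed-point equation gives the two
    bounds. *)

(** * Norms on finite sets, Young's inequality *)

Definition lnorm (R : realType) (T : finType) (n : nat) (f : T -> R) : R :=
  (\sum_t f t ^+ n) `^ n%:R^-1.

Section LNorm.
Variables (R : realType) (T : finType) (n : nat).
Hypothesis n_gt0 : (0 < n)%N.
Implicit Types f g u v : T -> R.

Local Notation N := (@lnorm R T n).

Lemma sum_exp_ge0 f : (forall t, 0 <= f t) -> 0 <= \sum_t f t ^+ n.
Proof. by move=> f0; apply: sumr_ge0 => t _; exact: exprn_ge0. Qed.

Lemma lnorm_ge0 f : 0 <= N f.
Proof. exact: powR_ge0. Qed.

Lemma lnormX f : (forall t, 0 <= f t) -> N f ^+ n = \sum_t f t ^+ n.
Proof.
move=> f0; rewrite /lnorm -powR_mulrn ?powR_ge0// -powRrM mulVf ?powRr1//.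
  exact: sum_exp_ge0.
by rewrite pnatr_eq0 -lt0n.
Qed.

Lemma lnorm_le f c : (forall t, 0 <= f t) -> 0 <= c ->
  \sum_t f t ^+ n <= c ^+ n -> N f <= c.
Proof.
by move=> f0 c0; rewrite -lnormX// ler_pXn2r// nnegrE// lnorm_ge0.
Qed.

Lemma ler_lnorm f g : (forall t, 0 <= f t <= g t) -> N f <= N g.
Proof.
move=> fg; have f0 t : 0 <= f t by have /andP[] := fg t.
have g0 t : 0 <= g t by have /andP[a b] := fg t; exact: le_trans b.
apply: lnorm_le; rewrite ?lnorm_ge0// lnormX//; apply: ler_sum => t _.
by rewrite ler_pXn2r ?nnegrE//; have /andP[] := fg t.
Qed.

Lemma lnorm_ge f t : (forall t, 0 <= f t) -> f t <= N f.
Proof.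
move=> f0; rewrite -(@ler_pXn2r _ n) ?nnegrE ?lnorm_ge0// lnormX//.
by rewrite (bigD1 t)//= lerDl sumr_ge0// => s _; rewrite exprn_ge0.
Qed.

Lemma lnormZ c f : 0 <= c -> (forall t, 0 <= f t) ->
  N (fun t => c * f t) = c * N f.
Proof.
move=> c0 f0; apply/eqP.
rewrite -(@eqrXn2 _ n)// ?lnorm_ge0 ?mulr_ge0 ?lnorm_ge0//.
rewrite exprMn !lnormX//; last by move=> t; rewrite mulr_ge0.
by rewrite mulr_sumr; apply/eqP; apply: eq_bigr => t _; rewrite exprMn.
Qed.

(** Normalise every factor to norm one and average the arithmetic-geometric
    mean inequality for the [n]-th powers over [T]. *)
Lemma hoelder_prod (F : 'I_n -> T -> R) : (forall k t, 0 <= F k t) ->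
  \sum_t \prod_k F k t <= \prod_k N (F k).
Proof.
move=> F0; have [/existsP[k /eqP Nk0]|/existsPn Nn0] :=
    boolP [exists k, N (F k) == 0].
  rewrite big1 ?prodr_ge0// => [|t _]; first by move=> i _; exact: lnorm_ge0.
  rewrite (bigD1 k)//= [F k t](_ : _ = 0) ?mul0r//.
  by apply/eqP; rewrite eq_le F0 -{1}Nk0 lnorm_ge.
have N0 k : 0 < N (F k) by rewrite lt0r Nn0 lnorm_ge0.
rewrite -[leRHS]mul1r -ler_pdivrMr ?prodr_gt0// mulr_suml.
have AGM t : (\prod_k F k t) / \prod_k N (F k) <=
             (\sum_k (F k t / N (F k)) ^+ n) / n%:R.
  have x0 k : 0 <= (F k t / N (F k)) by rewrite divr_ge0// ltW.
  rewrite -prodf_div -(@ler_pXn2r _ n) ?nnegrE//; last 2 first.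
  - by rewrite prodr_ge0.
  - by rewrite divr_ge0// sumr_ge0// => k _; rewrite exprn_ge0.
  rewrite -prodrXl.
  have := @leif_AGM R 'I_n predT (fun k => (F k t / N (F k)) ^+ n).
  rewrite cardT size_enum_ord => /(_ _)[|+ _]; last exact.
  by move=> k _; rewrite exprn_ge0.
rewrite (le_trans (ler_sum _ (fun t _ => AGM t)))// -mulr_suml exchange_big/=.
rewrite (eq_bigr (fun=> 1)) => [|k _]; last first.
  rewrite (eq_bigr (fun t => F k t ^+ n / N (F k) ^+ n)).
    by rewrite -mulr_suml -lnormX// divff// expf_neq0// gt_eqF.
  by move=> t _; rewrite expr_div_n.
by rewrite sumr_const card_ord divff// pnatr_eq0 -lt0n.
Qed.

(** The shape of every product estimated below: two distinguished factors
    and powers of two further functions. *)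
Lemma hoelder4 f g u v a b : n = (a + b).+2 ->
  (forall t, 0 <= f t) -> (forall t, 0 <= g t) ->
  (forall t, 0 <= u t) -> (forall t, 0 <= v t) ->
  \sum_t f t * g t * u t ^+ a * v t ^+ b <= N f * N g * N u ^+ a * N v ^+ b.
Proof.
move=> nE f0 g0 u0 v0.
pose G i : T -> R := if i is i'.+2 then if (i' < a)%N then u else v
                     else if i is 1%N then g else f.
have GE (H : (T -> R) -> R) :
    \prod_(k < n) H (G k) = H f * H g * H u ^+ a * H v ^+ b.
  rewrite nE !big_ord_recl/= mulrA -[RHS]mulrA big_split_ord/=; congr (_ * _).
  congr (_ * _).
    rewrite (eq_bigr (fun=> H u)) ?prodr_const ?card_ord// => i _.
    by rewrite ltn_ord.
  rewrite (eq_bigr (fun=> H v)) ?prodr_const ?card_ord// => i _.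
  by rewrite ltnNge leq_addr.
have G0 i t : 0 <= G i t.
  by rewrite /G; case: i => [|[|i]] //; case: ifP.
have := hoelder_prod (fun (k : 'I_n) t => G0 k t).
rewrite (GE N); apply: le_trans; rewrite le_eqVlt; apply/orP; left; apply/eqP.
by apply: eq_bigr => t _; rewrite (GE (@^~ t)).
Qed.

End LNorm.

Section Minkowski.
Variables (R : realType) (T : finType) (m : nat).
Implicit Types f g : T -> R.
Local Notation n := m.+2.
Local Notation N := (@lnorm R T n).

Lemma ler_lnormD f g : (forall t, 0 <= f t) -> (forall t, 0 <= g t) ->
  N (fun t => f t + g t) <= N f + N g.
Proof.
move=> f0 g0; set h := fun t => _; have h0 t : 0 <= h t by rewrite addr_ge0.
have [->|Nh0] := eqVneq (N h) 0; first by rewrite addr_ge0 ?lnorm_ge0.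
have {}Nh0 : 0 < N h by rewrite lt0r Nh0 lnorm_ge0.
rewrite -(@ler_pM2r _ (N h ^+ m.+1)) ?exprn_gt0// -exprS lnormX//.
have hE t : h t ^+ n = f t * h t * h t ^+ m * h t ^+ 0
                       + g t * h t * h t ^+ m * h t ^+ 0.
  by rewrite !expr0 !mulr1 -!mulrA -!exprS -mulrDl.
rewrite (eq_bigr _ (fun t _ => hE t)) big_split/= mulrDl exprS !mulrA.
by apply: lerD; rewrite -[leRHS]mulr1; apply: hoelder4; rewrite // addn0.
Qed.

Lemma ler_lnorm_sum (I : finType) (F : I -> T -> R) : (forall i t, 0 <= F i t) ->
  N (fun t => \sum_i F i t) <= \sum_i N (F i).
Proof.
move=> F0; elim: (index_enum I) => [|i s IH].
  rewrite big_nil; apply: lnorm_le => // [t|]; first by rewrite big_nil.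
  by rewrite expr0n/= big1// => t _; rewrite big_nil expr0n.
rewrite big_cons; apply: le_trans (lerD (lexx _) IH).
apply: le_trans (ler_lnormD _ _) => //; last by move=> t; rewrite sumr_ge0.
by apply: ler_lnorm => // t; rewrite sumr_ge0//= big_cons lexx.
Qed.

End Minkowski.

Section Young.
Variables (R : realType) (G : finZmodType) (m : nat).
Implicit Types f g h u v w : G -> R.
Local Notation n := m.+2.
Local Notation N := (@lnorm R G n).

(** Young's convolution inequality at the exponents
    1 + 1/n = 2/n + (n-1)/n, in multilinear form: one factor [h] of the kernel
    is attached to [w], the other is left alone, and summing over [i] decouples
    the two. *)
Lemma young_conv h w u v a b : m = (a + b)%N ->
  (forall t, 0 <= h t) -> (forall t, 0 <= w t) ->
  (forall t, 0 <= u t) -> (forall t, 0 <= v t) ->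
  N (fun i => \sum_j h (i - j) ^+ 2 * (w j * u j ^+ a * v j ^+ b)) <=
  N h ^+ 2 * (N w * N u ^+ a * N v ^+ b).
Proof.
move=> mE h0 w0 u0 v0.
have rhs0 : 0 <= N u ^+ a * N v ^+ b.
  by rewrite mulr_ge0 ?exprn_ge0 ?lnorm_ge0.
apply: lnorm_le => //.
- move=> i; apply: sumr_ge0 => j _; rewrite mulr_ge0// ?exprn_ge0//.
  by rewrite !mulr_ge0 ?exprn_ge0.
- by rewrite -mulrA !mulr_ge0 ?exprn_ge0 ?lnorm_ge0.
pose hw i j := h (i - j) * w j.
have hw0 i j : 0 <= hw i j by rewrite mulr_ge0.
have step i : \sum_j h (i - j) ^+ 2 * (w j * u j ^+ a * v j ^+ b) <=
    N (hw i) * (N h * (N u ^+ a * N v ^+ b)).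
  have -> : N h = N (fun j => h (i - j)).
    rewrite /lnorm; congr (_ `^ _).
    rewrite (reindex_inj (inv_inj (subKr i)))//=.
  rewrite !mulrA; under eq_bigr => j _.
    rewrite (_ : _ * _ = hw i j * h (i - j) * u j ^+ a * v j ^+ b); last first.
      by rewrite /hw; ring.
    over.
  by apply: hoelder4; rewrite // mE.
apply: (@le_trans _ _
    (\sum_i (N (hw i) * (N h * (N u ^+ a * N v ^+ b))) ^+ n)).
  apply: ler_sum => i _; rewrite ler_pXn2r ?nnegrE//.
    rewrite sumr_ge0// => j _; rewrite mulr_ge0 ?exprn_ge0//.
    by rewrite !mulr_ge0 ?exprn_ge0.
  by rewrite !mulr_ge0 ?lnorm_ge0 ?exprn_ge0 ?lnorm_ge0.
under eq_bigr do rewrite exprMn lnormX//.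
rewrite -mulr_suml (_ : \sum_i _ = (N h * N w) ^+ n).
  by rewrite -exprMn le_eqVlt; apply/orP; left; apply/eqP; congr (_ ^+ _); ring.
rewrite exprMn !lnormX// exchange_big/= mulr_sumr; apply: eq_bigr => j _.
rewrite (reindex_inj (addIr j))/= mulr_suml; apply: eq_bigr => i _.
by rewrite /hw addrK exprMn.
Qed.

End Young.

(** * The parameters gamma, delta and eps *)

Section Norms.
Variables (R : realType) (q : nat) (Q : 'Z_q -> R) (n : nat).
Hypothesis Qpos : forall j, 0 < Q j.

Lemma lpnorm_half : (0 < n)%N ->
  lpnorm (n%:R / 2) predT Q = lnorm n (fun j => Num.sqrt (Q j)) ^+ 2.
Proof.
move=> n0; rewrite /lpnorm /lnorm.
have -> : (n%:R / 2)^-1 = n%:R^-1 * 2%:R :> R by rewrite invf_div mulrC.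
rewrite powRrM powR_mulrn ?powR_ge0//; congr (_ `^ _ ^+ 2).
apply: eq_bigr => j _; rewrite (ger0_norm (ltW (Qpos j))).
have -> : n%:R / 2 = 2^-1 * n%:R :> R by rewrite mulrC.
by rewrite powRrM powR12_sqrt ?powR_mulrn ?sqrtr_ge0// ltW.
Qed.

Lemma lpnorm_off0 : (0 < n)%N ->
  lpnorm n%:R (predC1 0) Q = lnorm n (fun j => if j == 0 then 0 else Q j).
Proof.
move=> n0; rewrite /lpnorm /lnorm; congr (_ `^ _).
rewrite big_mkcond; apply: eq_bigr => j _; rewrite inE /=.
case: eqP => _ /=; first by rewrite expr0n eqn0Ngt n0.
by rewrite (ger0_norm (ltW (Qpos j))) powR_mulrn ?ltW.
Qed.

End Norms.

(** On the interval where [d * gamma * e ^+ d.-1 < 1] the map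
    [e |-> e - gamma * e ^+ d] is increasing, so the solution given by the
    intermediate value theorem is the smallest one. *)
Lemma smallest_solution_exists (R : realType) (m : nat) (gamma delta : R) :
  (0 < m)%N -> good_set m.+1 (gamma, delta) ->
  exists2 eps, smallest_positive_solution m.+1 gamma delta eps &
  eps < 1 /\
  2 * m.+1%:R * gamma * eps ^+ m + 2 * m.+1%:R * delta * eps ^+ m.+1 < 1.
Proof.
move=> m0 [/= gamma1 delta0 [e0 [e00 e0fix e0small]]].
have gamma0 : 0 <= gamma by rewrite ltW// (lt_trans _ gamma1).
pose f e := e - gamma * e ^+ m.+1.
have fc : {within `[0, e0], continuous f}.
  apply: continuous_subspaceT => x; apply: cvgB; first exact: cvg_id.
  by apply: cvgM; [exact: cvg_cst|exact: exprn_continuous].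
have [|eps] := IVT (v := delta) (ltW e00) fc.
  rewrite /f expr0n/= mulr0 subr0 ge_min le_max (ltW delta0)/= lerBrDr e0fix.
  by rewrite orbT.
rewrite in_itv/= => /andP[eps0 epse0] fE.
have epsE : eps = gamma * eps ^+ m.+1 + delta.
  by rewrite -fE /f addrC subrK.
have epsgt0 : 0 < eps.
  by rewrite epsE ltr_wpDl// mulr_ge0 ?exprn_ge0.
have small : 2 * m.+1%:R * gamma * eps ^+ m +
    2 * m.+1%:R * delta * eps ^+ m.+1 < 1.
  apply: le_lt_trans e0small; apply: lerD.
    by rewrite ler_wpM2l ?mulr_ge0// lerXn2r ?nnegrE ?(ltW e00).
  by rewrite ler_wpM2l ?mulr_ge0 ?(ltW delta0)// lerXn2r ?nnegrE ?(ltW e00).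
have small1 : m.+1%:R * (gamma * eps ^+ m) < 2^-1.
  rewrite -(ltr_pM2l (ltr0n _ 2)) divff ?pnatr_eq0// !mulrA.
  apply: le_lt_trans small; rewrite lerDl.
  by rewrite !mulr_ge0 ?(ltW delta0) ?exprn_ge0.
exists eps; last first.
  split=> //; rewrite ltNge; apply/negP => eps1.
  move: small1; apply/negP; rewrite -leNgt.
  have g1 : 1 <= gamma * eps ^+ m by rewrite mulr_ege1 ?exprn_ege1// ltW.
  apply: (@le_trans _ _ (1 * 1)); first by lra.
  by rewrite ler_pM// ler1n.
split=> // e [e_gt0 eE]; rewrite leNgt; apply/negP => lt.
have : eps - e = gamma * ((eps - e) * \sum_(i < m.+1) eps ^+ (m - i) * e ^+ i).
  by rewrite -(subrXX _ _ m.+1) [in LHS]epsE [in LHS]eE; ring.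
rewrite mulrCA -[LHS]mulr1 => /mulfI; rewrite subr_eq0 gt_eqF// => /(_ isT) h.
move: small1; rewrite ltNge => /negP; apply.
apply: (@le_trans _ _ 1); first by lra.
rewrite [leLHS]h mulrCA ler_wpM2l// mulr_natl -[X in _ *+ X]card_ord -sumr_const.
apply: ler_sum => i _; rewrite -[X in _ <= eps ^+ X](@subnK i m) -1?ltnS// exprD.
by rewrite ler_wpM2l ?exprn_ge0// lerXn2r ?nnegrE ?ltW.
Qed.

(** * The boundary law *)

Lemma cvg_fsumr (R : realType) (I : finType) (F : I -> nat -> R) (l : I -> R) :
  (forall i, F i n @[n --> \oo] --> l i) ->
  (\sum_i F i n) @[n --> \oo] --> \sum_i l i.
Proof.
move=> Fl; elim: (index_enum I) => [|i s IH].
  rewrite big_nil [X in X @ _ --> _](_ : _ = fun=> 0); first exact: cvg_cst.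
  by apply/funext => n; rewrite big_nil.
rewrite big_cons [X in X @ _ --> _](_ : _ = fun n => F i n + \sum_(j <- s) F j n).
  exact: cvgD.
by apply/funext => n; rewrite big_cons.
Qed.

Lemma cvg_expr (R : realType) (x : nat -> R) (l : R) k :
  x n @[n --> \oo] --> l -> (x n ^+ k) @[n --> \oo] --> l ^+ k.
Proof.
move=> xl; elim: k => [|k IH]; first exact: cvg_cst.
rewrite exprS [X in X @ _ --> _](_ : _ = fun n => x n * x n ^+ k).
  exact: cvgM.
by apply/funext => n; rewrite exprS.
Qed.

Lemma geometric_increments_cvg (R : realType) (x : nat -> R) C c : 0 <= c < 1 ->
  (forall n, `|x n.+1 - x n| <= C * c ^+ n) -> cvgn x.
Proof.
move=> /andP[c0 c1] xC.
have sx : cvgn (series (fun n => x n.+1 - x n)).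
  apply: normed_cvg; apply: (@series_le_cvg _ _ (geometric C c)) => //=.
  - by move=> n; rewrite (le_trans _ (xC n)).
  - by apply: is_cvg_geometric_series; rewrite ger0_norm.
have -> : x = (fun n => x 0%N + series (fun n => x n.+1 - x n) n).
  by apply/funext => n; rewrite /series/= telescope_sumr// subrKC.
by apply: is_cvgD => //; exact: is_cvg_cst.
Qed.

Section BoundaryLaw.
Variables (R : realType) (G : finZmodType) (m : nat) (Q : G -> R).
Hypothesis Qpos : forall i, 0 < Q i.
Hypothesis Qeven : forall i, Q (- i) = Q i.
Hypothesis Q0 : Q 0 = 1.

Local Notation d := m.+1.
Local Notation N := (@lnorm R G d.+1).

Let h i := Num.sqrt (Q i).
Let Qoff i := if i == 0 then 0 else Q i.
Let gamma := N h ^+ 2.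
Let delta := N Qoff.

Variable eps : R.
Hypothesis eps_gt0 : 0 < eps.
Hypothesis eps_fix : eps = gamma * eps ^+ d + delta.
Hypothesis eps_contr : d%:R * gamma * eps ^+ m + d%:R * delta * eps ^+ d < 1.

Let h0 i : 0 <= h i. Proof. exact: sqrtr_ge0. Qed.
Let h2 i : h i ^+ 2 = Q i. Proof. by rewrite sqr_sqrtr// ltW. Qed.
Let Qge0 i : 0 <= Q i. Proof. exact: ltW. Qed.
Let Qoff0 i : 0 <= Qoff i. Proof. by rewrite /Qoff; case: ifP. Qed.
Let gamma0 : 0 <= gamma. Proof. by rewrite exprn_ge0 ?lnorm_ge0. Qed.
Let delta0 : 0 <= delta. Proof. exact: lnorm_ge0. Qed.
Let eps0 : 0 <= eps. Proof. exact: ltW. Qed.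

Implicit Types f g w : G -> R.

Let A f i := \sum_j Q (i - j) * f j ^+ d.
Let B f := \sum_j Q j * f j ^+ d.

(** The recursion for the boundary law off the ground state: if [u] equals [1]
    at [0] and [f] elsewhere, then [Q i + A f i] is the sum over [j] of
    [Q (i - j) * u j ^+ d]. *)
Let step f i := if i == 0 then 0 else (Q i + A f i) / (1 + B f).

Let in_ball f := [/\ f 0 = 0, forall i, 0 <= f i & N f <= eps].

Let A_ge0 f : (forall i, 0 <= f i) -> forall i, 0 <= A f i.
Proof. by move=> f0 i; apply: sumr_ge0 => j _; rewrite mulr_ge0 ?exprn_ge0. Qed.

Let B_ge0 f : (forall i, 0 <= f i) -> 0 <= B f.
Proof. by move=> f0; apply: sumr_ge0 => j _; rewrite mulr_ge0 ?exprn_ge0. Qed.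

Let conv_le w f g a b : m = (a + b)%N ->
  (forall i, 0 <= w i) -> (forall i, 0 <= f i) -> (forall i, 0 <= g i) ->
  N (fun i => \sum_j Q (i - j) * (w j * f j ^+ a * g j ^+ b)) <=
  gamma * (N w * N f ^+ a * N g ^+ b).
Proof.
move=> mE w0 f0 g0; apply: le_trans (young_conv mE h0 w0 f0 g0).
apply: ler_lnorm => // i; apply/andP; split.
  by apply: sumr_ge0 => j _; rewrite !mulr_ge0 ?exprn_ge0.
by rewrite le_eqVlt; apply/orP; left; apply/eqP/eq_bigr => j _; rewrite h2.
Qed.

Let pair_le w f g a b : m = (a + b)%N -> w 0 = 0 ->
  (forall i, 0 <= w i) -> (forall i, 0 <= f i) -> (forall i, 0 <= g i) ->
  \sum_j Q j * (w j * f j ^+ a * g j ^+ b) <= delta * (N w * N f ^+ a * N g ^+ b).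
Proof.
move=> mE w00 w0 f0 g0.
have nE : d.+1 = (a + b).+2 by rewrite mE.
rewrite !mulrA; apply: le_trans (hoelder4 _ nE Qoff0 w0 f0 g0) => //.
apply: ler_sum => j _; rewrite /Qoff; case: eqP => [->|_]; last by rewrite !mulrA.
by rewrite w00 !(mul0r, mulr0).
Qed.

Let A_le f : (forall i, 0 <= f i) -> N (A f) <= gamma * N f ^+ d.
Proof.
move=> f0; have := conv_le (esym (addn0 m)) f0 f0 f0.
rewrite expr0 mulr1 -exprS; apply: le_trans.
apply: ler_lnorm => // i; rewrite A_ge0//= le_eqVlt; apply/orP; left.
by apply/eqP/eq_bigr => j _; rewrite expr0 mulr1 exprS.
Qed.

Let B_le f : f 0 = 0 -> (forall i, 0 <= f i) -> B f <= delta * N f ^+ d.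
Proof.
move=> f00 f0; have := pair_le (esym (addn0 m)) f00 f0 f0 f0.
rewrite expr0 mulr1 -exprS; apply: le_trans.
by rewrite le_eqVlt; apply/orP; left; apply/eqP/eq_bigr => j _;
  rewrite expr0 mulr1 exprS.
Qed.

Let step_ge0 f : (forall i, 0 <= f i) -> forall i, 0 <= step f i.
Proof.
move=> f0 i; rewrite /step; case: ifP => // _.
by rewrite divr_ge0// addr_ge0 ?A_ge0 ?B_ge0.
Qed.

Let step_ball f : in_ball f -> in_ball (step f).
Proof.
move=> [f00 f0 fe]; split; [by rewrite /step eqxx|exact: step_ge0|].
have B1 : 1 <= 1 + B f by rewrite lerDl B_ge0.
have B0 : 0 < 1 + B f by exact: lt_le_trans B1.
rewrite [leRHS]eps_fix [leRHS]addrC.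
apply: (@le_trans _ _ (N (fun i => Qoff i + A f i))).
  apply: ler_lnorm => // i; rewrite step_ge0//= /step /Qoff.
  case: eqP => _; first by rewrite add0r A_ge0.
  by rewrite ler_pdivrMr ?ler_peMr ?addr_ge0 ?A_ge0.
apply: le_trans (ler_lnormD _ Qoff0 (A_ge0 f0)) _.
rewrite lerD2l (le_trans (A_le f0))// ler_wpM2l// ler_pXn2r ?nnegrE//.
exact: lnorm_ge0.
Qed.

Let c := d%:R * gamma * eps ^+ m + d%:R * delta * eps ^+ d.

Let c_ge0 : 0 <= c.
Proof. by rewrite addr_ge0// mulr_ge0 ?exprn_ge0// mulr_ge0. Qed.

Let diff f g i := `|f i - g i|.

Let power_diff f g j : (forall i, 0 <= f i) -> (forall i, 0 <= g i) ->
  `|f j ^+ d - g j ^+ d| <= \sum_(k < d) diff f g j * f j ^+ (m - k) * g j ^+ k.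
Proof.
move=> f0 g0; rewrite subrXX normrM [X in _ * X]ger0_norm.
  by rewrite /diff mulr_sumr; apply: ler_sum => k _; rewrite mulrA.
by apply: sumr_ge0 => k _; rewrite mulr_ge0 ?exprn_ge0.
Qed.

Let ball_prod f g w (k : 'I_d) : in_ball f -> in_ball g ->
  N w * N f ^+ (m - k) * N g ^+ k <= N w * eps ^+ m.
Proof.
move=> [_ f0 fe] [_ g0 ge]; rewrite -mulrA ler_wpM2l ?lnorm_ge0//.
rewrite -[X in eps ^+ X](@subnK k m) -1?ltnS ?ltn_ord// exprD.
by rewrite ler_pM ?exprn_ge0 ?lnorm_ge0// lerXn2r ?nnegrE ?lnorm_ge0.
Qed.

Let subkm (k : 'I_d) : m = (m - k + k)%N.
Proof. by rewrite subnK// -ltnS ltn_ord. Qed.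

Let A_diff f g : in_ball f -> in_ball g ->
  N (diff (A f) (A g)) <= d%:R * gamma * eps ^+ m * N (diff f g).
Proof.
move=> fb gb; have [_ f0 fe] := fb; have [_ g0 ge] := gb.
have w0 i : 0 <= diff f g i by exact: normr_ge0.
pose F (k : 'I_d) i :=
  \sum_j Q (i - j) * (diff f g j * f j ^+ (m - k) * g j ^+ k).
have F0 k i : 0 <= F k i.
  by apply: sumr_ge0 => j _; rewrite !mulr_ge0 ?exprn_ge0.
apply: (@le_trans _ _ (N (fun i => \sum_k F k i))).
  apply: ler_lnorm => // i; rewrite normr_ge0/= /diff /A -sumrB.
  rewrite (le_trans (ler_norm_sum _ _ _))// exchange_big/=.
  apply: ler_sum => j _; rewrite -mulrBr normrM ger0_norm//.
  by rewrite -mulr_sumr ler_wpM2l// power_diff.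
apply: le_trans (ler_lnorm_sum _ F0) _.
apply: (@le_trans _ _ (\sum_(k < d) gamma * (N (diff f g) * eps ^+ m))).
  apply: ler_sum => k _; apply: le_trans (conv_le (subkm k) w0 f0 g0) _.
  by rewrite ler_wpM2l// ball_prod.
rewrite sumr_const card_ord -mulr_natl le_eqVlt; apply/orP; left.
by apply/eqP; ring.
Qed.

Let B_diff f g : in_ball f -> in_ball g ->
  `|B f - B g| <= d%:R * delta * eps ^+ m * N (diff f g).
Proof.
move=> fb gb; have [f00 f0 fe] := fb; have [g00 g0 ge] := gb.
have w0 i : 0 <= diff f g i by exact: normr_ge0.
have w00 : diff f g 0 = 0 by rewrite /diff f00 g00 subrr normr0.
apply: (@le_trans _ _ (\sum_(k < d) \sum_j
    Q j * (diff f g j * f j ^+ (m - k) * g j ^+ k))).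
  rewrite /B -sumrB exchange_big/= (le_trans (ler_norm_sum _ _ _))//.
  apply: ler_sum => j _; rewrite -mulrBr normrM ger0_norm//.
  by rewrite -mulr_sumr ler_wpM2l// power_diff.
apply: (@le_trans _ _ (\sum_(k < d) delta * (N (diff f g) * eps ^+ m))).
  apply: ler_sum => k _; apply: le_trans (pair_le (subkm k) w00 w0 f0 g0) _.
  by rewrite ler_wpM2l// ball_prod.
rewrite sumr_const card_ord -mulr_natl le_eqVlt; apply/orP; left.
by apply/eqP; ring.
Qed.

(** Since [step f - step g] is
    [(A f - A g - (B f - B g) * step g) / (1 + B f)], the denominators
    contribute with a factor [N (step g) <= eps]. *)
Let step_contraction f g : in_ball f -> in_ball g ->
  N (diff (step f) (step g)) <= c * N (diff f g).
Proof.
move=> fb gb; have [f00 f0 fe] := fb; have [g00 g0 ge] := gb.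
have [_ sg0 sge] := step_ball gb.
have Bf1 : 1 <= 1 + B f by rewrite lerDl B_ge0.
have Bg1 : 1 <= 1 + B g by rewrite lerDl B_ge0.
have Bf0 : 0 < 1 + B f by exact: lt_le_trans Bf1.
have Bg0 : 0 < 1 + B g by exact: lt_le_trans Bg1.
pose e := `|B f - B g|.
apply: (@le_trans _ _ (N (fun i => diff (A f) (A g) i + e * step g i))).
  apply: ler_lnorm => // i; rewrite normr_ge0/=.
  have [->|i0] := eqVneq i 0.
    by rewrite /diff /step eqxx subrr normr0 mulr0 addr0.
  have sE x : step x i = (Q i + A x i) / (1 + B x).
    by rewrite /step (negPf i0).
  have -> : diff (step f) (step g) i =
      `|(A f i - A g i) + (B g - B f) * step g i| / (1 + B f).
    rewrite -[X in _ / X](gtr0_norm Bf0) -normf_div; congr `|_|.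
    rewrite !sE; field.
    by rewrite !gt_eqF.
  rewrite ler_pdivrMr//; apply: le_trans (ler_peMr _ Bf1).
    apply: le_trans (ler_normD _ _) _; rewrite lerD2l normrM distrC.
    by rewrite [X in _ * X]ger0_norm.
  by rewrite addr_ge0 ?mulr_ge0 ?normr_ge0.
apply: le_trans (ler_lnormD _ _ _) _.
- by move=> i; exact: normr_ge0.
- by move=> i; rewrite mulr_ge0 ?normr_ge0.
rewrite lnormZ ?normr_ge0// mulrDl lerD ?A_diff//.
apply: le_trans (ler_pM _ _ (B_diff fb gb) sge) _ => //; first exact: lnorm_ge0.
by rewrite le_eqVlt; apply/orP; left; apply/eqP; rewrite exprS; ring.
Qed.

Let iterate n := iter n step (fun=> 0).

Let iterate_ball n : in_ball (iterate n).
Proof.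
elim: n => [|n IH]; last exact: step_ball.
split=> //; apply: lnorm_le => //; rewrite big1 ?exprn_ge0// => i _.
by rewrite expr0n.
Qed.

Let iterate_cvg i : cvgn (fun n => iterate n i).
Proof.
apply: (@geometric_increments_cvg _ _
  (N (diff (iterate 1) (iterate 0))) c) => [|n]; first by rewrite c_ge0.
have dn : N (diff (iterate n.+1) (iterate n)) <=
          N (diff (iterate 1) (iterate 0)) * c ^+ n.
  elim: n => [|n IH]; first by rewrite mulr1.
  apply: le_trans (step_contraction _ _) _; [exact: (iterate_ball n.+1)|exact: iterate_ball|].
  by rewrite exprS mulrCA ler_wpM2l.
apply: le_trans dn.
apply: (@lnorm_ge _ _ d.+1 _ (diff (iterate n.+1) (iterate n))) => // t.
exact: normr_ge0.
Qed.

Let step_fixpoint : exists2 f, in_ball f & step f = f.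
Proof.
pose f i := limn (fun n => iterate n i).
have fl i : iterate n i @[n --> \oo] --> f i by exact: iterate_cvg.
have f0 i : 0 <= f i.
  apply: limr_ge; first exact: iterate_cvg.
  by apply: nearW => n; have [_ + _] := iterate_ball n.
exists f.
  split=> //.
    rewrite /f (_ : (fun _ => _) = fun=> 0) ?lim_cst//.
    by apply/funext => n; have [+ _ _] := iterate_ball n.
  apply: lnorm_le => //.
  have cs : (\sum_i iterate n i ^+ d.+1) @[n --> \oo] --> \sum_i f i ^+ d.+1.
    by apply: cvg_fsumr => i; exact: cvg_expr.
  rewrite -(cvg_lim _ cs)//; apply: limr_le; first by apply/cvg_ex; eexists; exact: cs.
  apply: nearW => n; have [_ n0 ne] := iterate_ball n.
  by rewrite -lnormX// ler_pXn2r ?nnegrE ?lnorm_ge0.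
apply/funext => i.
have cA : A (iterate n) i @[n --> \oo] --> A f i.
  apply: cvg_fsumr => j; apply: cvgM; first exact: cvg_cst.
  exact: cvg_expr.
have cB : B (iterate n) @[n --> \oo] --> B f.
  apply: cvg_fsumr => j; apply: cvgM; first exact: cvg_cst.
  exact: cvg_expr.
have cs : step (iterate n) i @[n --> \oo] --> step f i.
  rewrite /step; case: ifP => _; first exact: cvg_cst.
  apply: cvgM; first by apply: cvgD => //; exact: cvg_cst.
  apply: cvgV; last by apply: cvgD => //; exact: cvg_cst.
  by rewrite gt_eqF// ltr_wpDr// B_ge0.
by move/cvg_lim : (fl i) => <-//; apply/esym/cvg_lim => //; rewrite -cvg_shiftS.
Qed.

(** The fixed point [f] lies within
    [gamma * N f ^+ d + delta * N f ^+ d * delta] of [Q] off [0].  In the first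
    term one factor [N f] is kept, all others are bounded by [eps], and both
    bounds follow from the triangle inequality. *)
Lemma boundary_law_exists : exists u : G -> R,
  let nu := N (fun i => if i == 0 then 0 else u i) in
  [/\ (forall i, 0 < u i) /\ u 0 = 1,
      (forall i, \sum_j Q (i - j) * u j ^+ d = (\sum_j Q j * u j ^+ d) * u i),
      nu <= eps,
      nu * (1 - gamma * eps ^+ m) <= delta * (1 + delta * eps ^+ d)
    & delta * (1 - delta * eps ^+ d) <= nu * (1 + gamma * eps ^+ m)].
Proof.
have [f [f00 f0 fe] sf] := step_fixpoint.
have B0 : 0 < 1 + B f by rewrite ltr_wpDr// B_ge0.
pose u i := if i == 0 then 1 else f i.
have fE i : i != 0 -> f i = (Q i + A f i) / (1 + B f).
  by move=> i0; rewrite -[LHS](congr1 (@^~ i) sf) /step (negPf i0).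
have uE i : \sum_j Q (i - j) * u j ^+ d = Q i + A f i.
  rewrite /A [LHS](bigD1 0)//= [in RHS](bigD1 0)//= f00 expr0n/= mulr0 add0r.
  rewrite /u eqxx expr1n subr0 mulr1; congr (_ + _).
  by apply: eq_bigr => j /negPf ->.
have offE i : (if i == 0 then 0 else u i) = f i.
  by rewrite /u; case: eqP => // ->.
have AB0 : A f 0 = B f by apply: eq_bigr => j _; rewrite sub0r Qeven.
have cE : \sum_j Q j * u j ^+ d = 1 + B f.
  by rewrite -AB0 -Q0 -uE; apply: eq_bigr => j _; rewrite sub0r Qeven.
have Af0 := A_ge0 f0; have Bf0 := B_ge0 f0.
pose err i := A f i + B f * Qoff i.
have err0 i : 0 <= err i by rewrite addr_ge0 ?mulr_ge0.
have errN : N err <= delta * (delta * eps ^+ d) + N f * (gamma * eps ^+ m).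
  apply: le_trans (ler_lnormD _ Af0 _) _; first by move=> i; rewrite mulr_ge0.
  rewrite addrC lnormZ// lerD//.
    rewrite mulrC ler_wpM2l// (le_trans (B_le f00 f0))// ler_wpM2l//.
    by rewrite lerXn2r ?nnegrE ?lnorm_ge0.
  rewrite (le_trans (A_le f0))// mulrCA ler_wpM2l// exprS ler_wpM2l ?lnorm_ge0//.
  by rewrite lerXn2r ?nnegrE ?lnorm_ge0.
exists u => /=; rewrite (_ : (fun _ => _) = f); last exact/funext.
split=> //.
- split; last by rewrite /u eqxx.
  move=> i; rewrite /u; case: eqP => // /eqP /fE ->.
  by rewrite divr_gt0// ltr_pwDl// A_ge0.
- move=> i; rewrite uE cE /u; case: eqP => [->|/eqP /fE ->].
    by rewrite AB0 Q0 mulr1.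
  by rewrite mulrC divfK ?gt_eqF.
- rewrite mulrBr mulr1 lerBlDr mulrDr mulr1 -addrA.
  apply: le_trans (_ : N f <= delta + N err) (lerD (lexx _) errN).
  apply: le_trans (ler_lnormD _ Qoff0 err0); apply: ler_lnorm => // i.
  rewrite f0/=; have [->|i0] := eqVneq i 0; first by rewrite f00 addr_ge0.
  rewrite fE// ler_pdivrMr// /err /Qoff (negPf i0) -subr_ge0 (_ : _ - _ =
    B f * Q i + (Q i + A f i + B f * Q i) * B f); last by ring.
  by rewrite addr_ge0 ?mulr_ge0// !addr_ge0 ?mulr_ge0.
- rewrite mulrBr mulr1 lerBlDr [X in X + _]mulrDr mulr1 -addrA [X in _ + X]addrC.
  apply: le_trans (_ : delta <= N f + N err) (lerD (lexx _) errN).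
  apply: le_trans (ler_lnormD _ f0 err0); apply: ler_lnorm => // i.
  rewrite Qoff0/=; have [->|i0] := eqVneq i 0.
    by rewrite {1}/Qoff eqxx addr_ge0.
  rewrite fE// -lerBlDr ler_pdivlMr// /err /Qoff (negPf i0) -subr_ge0.
  rewrite (_ : _ - _ = A f i + A f i + A f i * B f + B f * B f * Q i); last by ring.
  by rewrite !addr_ge0 ?mulr_ge0.
Qed.

End BoundaryLaw.

(** * Finite subtrees and an enumeration of the tree *)

Section Subtrees.
Variables (V : choiceType) (adj : rel V).
Local Open Scope fset_scope.

(** The finite connected vertex sets, generated by attaching leaves. *)
Inductive subtree : {fset V} -> Prop :=
| subtree1 x : subtree [fset x]
| subtreeU S x y : subtree S -> x \in S -> y \notin S -> adj x y ->
    subtree (y |` S).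

Lemma subtree_neq0 S : subtree S -> exists x, x \in S.
Proof.
by case=> [x|S' x y _ _ _ _]; [exists x|exists y]; rewrite !inE eqxx.
Qed.

Hypothesis adj_sym : symmetric adj.

Lemma subtree_path S : subtree S -> forall a b, a \in S -> b \in S ->
  exists p, [/\ path adj a p, last a p = b & {subset p <= S}].
Proof.
elim=> [x a b|{}S x y _ IH xS yS xy a b].
  by rewrite !inE => /eqP-> /eqP->; exists [::].
rewrite !inE => /predU1P[->|aS] /predU1P[->|bS].
- by exists [::].
- have [p [xp pb pS]] := IH x b xS bS; exists (x :: p); split=> //=.
    by rewrite adj_sym xy.
  by move=> z; rewrite !inE => /predU1P[->|/pS->]; rewrite ?xS orbT.
- have [p [xp pb pS]] := IH a x aS xS; exists (rcons p y); split.
  + by rewrite rcons_path xp pb.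
  + by rewrite last_rcons.
  + by move=> z; rewrite mem_rcons !inE => /predU1P[->|/pS->];
      rewrite ?eqxx ?orbT.
- have [p [xp pb pS]] := IH a b aS bS; exists p; split=> // z /pS zS.
  by rewrite !inE zS orbT.
Qed.

Lemma path_exit (S : {fset V}) p a : path adj a p -> a \in S ->
  last a p \notin S -> exists x y, [/\ x \in S, y \notin S, y \in p & adj x y].
Proof.
elim: p a => [a _ /= -> //|b p IH a /= /andP[ab bp] aS lS].
have [bS|bS] := boolP (b \in S); last by exists a, b; rewrite mem_head.
have [x [y [xS yS yp xy]]] := IH b bp bS lS.
by exists x, y; rewrite inE yp orbT.
Qed.

Lemma subtree_grow S S' : subtree S -> subtree S' -> S `<=` S' -> S != S' ->
  exists x y, [/\ x \in S, y \in S', y \notin S & adj x y].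
Proof.
move=> tS tS' SS' neq.
have [b bS' bS] : exists2 b, b \in S' & b \notin S.
  apply/fsubsetPn; apply: contra neq => S'S.
  by rewrite eqEfsubset SS' S'S.
have [a aS] := subtree_neq0 tS.
have [p [ap pb pS']] := subtree_path tS' (fsubsetP SS' _ aS) bS'.
have [|x [y [xS yS yp xy]]] := path_exit ap aS; first by rewrite pb.
by exists x, y; split=> //; exact: pS'.
Qed.

Hypothesis acyclic : forall p : seq V, (2 < size p)%N -> ~~ ucycleb adj p.

(** Two distinct neighbours of [y] in [S] would close a cycle through [y]. *)
Lemma subtree_unique_nbr S x x' y : subtree S -> x \in S -> x' \in S ->
  y \notin S -> adj x y -> adj x' y -> x = x'.
Proof.
move=> tS xS x'S yS xy x'y; apply/eqP/negP => /negP neq.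
have [p [xp px' pS]] := subtree_path tS xS x'S.
move: px' neq x'y; case: (shortenP xp) => p' xp' up' sub <- neq x'y.
have p'S : {subset p' <= S} by move=> z /sub /pS.
have := acyclic (p := y :: x :: p'); rewrite /ucycleb.
move: neq up' xp' x'y p'S; case: p' {sub} => [|z p']; first by rewrite eqxx.
move=> _ up' xp' x'y p'S /(_ isT) /negP; apply.
rewrite /= rcons_path adj_sym xy/=.
move: xp' => /= /andP[-> ->]/=; rewrite x'y/=.
move: up' => /= -> ; rewrite andbT !inE !negb_or.
apply/and3P; split.
- by apply: contraNN yS => /eqP->.
- by apply: contraNN yS => /eqP->; rewrite p'S// mem_head.
- by apply: contraNN yS => yp'; rewrite p'S// inE yp' orbT.
Qed.

End Subtrees.

Section Enumeration.
Variables (d : nat) (V : choiceType) (adj : rel V).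
Hypothesis tree : cayley_tree d adj.
Local Open Scope fset_scope.

Fixpoint prefix (x : nat -> V) n : {fset V} :=
  if n is n'.+1 then x n' |` prefix x n' else fset0.

Lemma in_prefix x n v : reflect (exists2 i, (i < n)%N & v = x i) (v \in prefix x n).
Proof.
elim: n => [|n IH] /=; first by rewrite inE; constructor => -[].
rewrite !inE; apply: (iffP predU1P) => [[->|/IH[i ilt ->]]|[i]].
- by exists n.
- by exists i => //; exact: ltnW.
- by rewrite ltnS leq_eqVlt => /predU1P[-> ->|ilt vE];
    [left|right; apply/IH; exists i].
Qed.

Lemma cayley_tree_inhabited : inhabited V.
Proof.
apply: contrapT => none; have [_ Vinf _ _ _] := tree; apply: Vinf.
by apply: (@sub_finite_set _ _ set0) => // v _; apply: none.
Qed.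

Lemma nbrs_exist x : exists s : seq V, s =i adj x.
Proof.
by have [_ _ _ _ /(_ x)[N Nx _]] := tree; exists (enum_fset N) => y; rewrite -Nx.
Qed.

Let nbrs x := sval (cid (nbrs_exist x)).
Let in_nbrs x y : (y \in nbrs x) = adj x y.
Proof. by rewrite /nbrs; case: cid => s /= ->. Qed.

Variable o : V.

(** Breadth-first search: stage [k] appends the new neighbours of the [k]-th
    vertex found. *)
Let Fixpoint bfs k : seq V := if k is k'.+1 then
    bfs k' ++ [seq y <- undup (nbrs (nth o (bfs k') k')) | y \notin bfs k']
  else [:: o].

Let bfs_cat k n : exists t, bfs (n + k) = bfs k ++ t.
Proof.
elim: n => [|n [t IH]]; first by exists [::]; rewrite cats0.
by rewrite addSn /= {1}IH -catA; eexists; reflexivity.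
Qed.

Let nth_bfs k n i : (k <= n)%N -> (i < size (bfs k))%N ->
  nth o (bfs n) i = nth o (bfs k) i.
Proof.
by move=> kn ik; have [t] := bfs_cat k (n - k); rewrite subnK// => ->; rewrite nth_cat ik.
Qed.

Let sub_bfs k n : (k <= n)%N -> {subset bfs k <= bfs n}.
Proof.
move=> kn y yk; have [t] := bfs_cat k (n - k); rewrite subnK// => ->.
by rewrite mem_cat yk.
Qed.

Let bfs_uniq k : uniq (bfs k).
Proof.
elim: k => //= k IH; rewrite cat_uniq IH/= filter_uniq ?undup_uniq// andbT.
by apply/hasPn => y; rewrite mem_filter => /andP[].
Qed.

Let connected_closed (A : pred V) : A o -> (forall x y, A x -> adj x y -> A y) ->
  forall v, A v.
Proof.
move=> Ao Acl v; have [_ _ /(_ o v)[p op <-] _ _] := tree.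
elim: p o op Ao => //= y p IH x /andP[xy yp] Ax.
by apply: IH => //; exact: Acl xy.
Qed.

Let bfs_nbrs k y : adj (nth o (bfs k) k) y -> y \in bfs k.+1.
Proof.
rewrite -in_nbrs /= mem_cat mem_filter mem_undup => ->.
by rewrite andbT orbN.
Qed.

(** An exhausted search would have visited a finite set closed under
    adjacency. *)
Let bfs_size k : (k < size (bfs k))%N.
Proof.
elim/ltn_ind: k => k IH; rewrite ltnNge; apply/negP => sk.
have [_ Vinf _ _ _] := tree; apply: Vinf.
have all_in v : v \in bfs k.
  apply: (connected_closed (A := [in bfs k])).
    by apply: (sub_bfs (leq0n k)); rewrite inE.
  move=> x y xk xy.
  have ik : (index x (bfs k) < k)%N by rewrite (leq_trans _ sk)// index_mem.
  apply: (sub_bfs ik); apply: bfs_nbrs.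
  by rewrite -(nth_bfs (ltnW ik)) ?IH// nth_index.
apply: (@sub_finite_set _ _ [set` bfs k]); last exact: finite_seq.
by move=> v _; exact: all_in.
Qed.

Let bfs_parent k j : (0 < j < size (bfs k))%N ->
  exists2 i, (i < j)%N & adj (nth o (bfs k) i) (nth o (bfs k) j).
Proof.
elim: k j => [[|[]]//|k IH j /andP[j0]].
have [jk _|kj] := ltnP j (size (bfs k)).
  have [|i ij] := IH j; first by rewrite j0.
  by rewrite -!(nth_bfs (leqnSn k))// ?(ltn_trans ij)// => ?; exists i.
move=> jk1; exists k; first by rewrite (leq_trans _ kj).
rewrite (nth_bfs (leqnSn k)) ?bfs_size// -in_nbrs /= nth_cat ltnNge kj/=.
move: jk1; rewrite /= size_cat -ltn_subLR// => /(mem_nth o).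
by rewrite mem_filter mem_undup => /andP[].
Qed.

(** Every vertex but the first is enumerated after one of its neighbours, so
    that the tree is built by attaching leaves. *)
Lemma subtree_enumeration : exists x : nat -> V,
  [/\ injective x, forall v, exists n, x n = v &
      forall n, subtree adj (prefix x n.+1)].
Proof.
pose x n := nth o (bfs n) n.
have xE n k : (n <= k)%N -> x n = nth o (bfs k) n.
  by move=> nk; rewrite (nth_bfs nk).
have xinj : injective x.
  move=> a b ab; have am := leq_maxl a b; have bm := leq_maxr a b.
  move: ab; rewrite (xE _ _ am) (xE _ _ bm) => /eqP; rewrite nth_uniq//.
  - by move=> /eqP.
  - by rewrite (leq_ltn_trans am).
  - by rewrite (leq_ltn_trans bm).
have xbfs v k : v \in bfs k -> exists n, x n = v.
  move=> vk; exists (index v (bfs k)).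
  have := vk; rewrite -index_mem => vs.
  have [le|/ltnW le] := leqP (index v (bfs k)) k.
    by rewrite (xE _ _ le) nth_index.
  by rewrite /x (nth_bfs le)// nth_index.
exists x; split=> //.
- pose A v := `[< exists n, x n = v >].
  move=> v; apply/asboolP; apply: (connected_closed (A := A)).
    by apply/asboolP; exists 0%N.
  move=> _ y /asboolP[n <-] xny; apply/asboolP; apply: (xbfs _ n.+1).
  exact: bfs_nbrs.
- elim=> [|n IH]; first by rewrite /= fsetU0; constructor.
  have [|i iN] := @bfs_parent n.+1 n.+1; first by rewrite /= bfs_size.
  rewrite -!xE ?(ltnW iN)// => adjx.
  apply: (subtreeU IH _ _ adjx).
    by apply/in_prefix; exists i.
  by apply/in_prefix => -[j jn /xinj jE]; rewrite jE ltnn in jn.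
Qed.

End Enumeration.

(** * Weights of configurations on finite subtrees *)

Definition update (V : eqType) (T : Type) (w : V -> T) (y : V) (a : T) : V -> T :=
  fun v => if v == y then a else w v.

Section BoundaryWeights.
Variables (R : realType) (d q : nat) (V : choiceType) (adj : rel V).
Variables (Q u : 'Z_q -> R) (c : R).
Hypothesis tree : cayley_tree d adj.
Hypothesis Qeven : forall j : 'Z_q, Q (- j) = Q j.
Hypothesis Qpos : forall j, 0 < Q j.
Hypothesis upos : forall j, 0 < u j.
Hypothesis u_law : forall i : 'Z_q, \sum_j Q (i - j) * u j ^+ d = c * u i.
Local Open Scope fset_scope.
Implicit Types (S : {fset V}) (w : config V q).

Let adj_sym : symmetric adj. Proof. by have [[]] := tree. Qed.
Let adj_irr : irreflexive adj. Proof. by have [[]] := tree. Qed.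

Definition inner_degree S x := #|` [fset y in S | adj x y]|.

Definition inner_edges S : {fset {fset V}} :=
  [fset e in fpowerset S | `[< edges adj e >]].

(** The weight of [w] on [S] when the boundary law [u ^+ d] is put on the
    neighbours of [S] and these are summed out: each of the
    [d.+1 - inner_degree S x] neighbours of [x] off [S] contributes [u (w x)],
    up to a constant factor. *)
Definition tree_weight S w : R :=
  (\prod_(x <- S) u (w x) ^+ (d.+1 - inner_degree S x)) *
  \prod_(e <- inner_edges S) edge_weight Q w e.

Lemma in_inner_edges S e :
  reflect (e `<=` S /\ edges adj e) (e \in inner_edges S).
Proof.
rewrite !inE fpowersetE; apply: (iffP andP) => [[-> /asboolP]|[-> eE]] //.
by split=> //; exact/asboolP.
Qed.

Lemma eq_edge_weight e w w' : {in e, w =1 w'} ->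
  edge_weight Q w e = edge_weight Q w' e.
Proof.
rewrite /edge_weight => ww'.
have {}ww' x : x \in enum_fset e -> w x = w' x by move=> xe; exact: ww'.
case: (enum_fset e) ww' => [|x [|y [|z s]]]// ww'.
by rewrite !ww' ?inE ?eqxx ?orbT.
Qed.

Lemma eq_tree_weight S w w' : {in S, w =1 w'} ->
  tree_weight S w = tree_weight S w'.
Proof.
move=> ww'; congr (_ * _).
  by apply: eq_big_seq => x xS; rewrite ww'.
apply: eq_big_seq => e /in_inner_edges[/fsubsetP eS _].
by apply: eq_edge_weight => x /eS; exact: ww'.
Qed.

Lemma edge_weight_gt0 e w : 0 < edge_weight Q w e.
Proof. by rewrite /edge_weight; case: (enum_fset e) => [|x [|y [|z s]]]. Qed.

Lemma tree_weight_gt0 S w : 0 < tree_weight S w.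
Proof.
rewrite mulr_gt0// prodr_gt0// => [x _|e _]; first exact: exprn_gt0.
exact: edge_weight_gt0.
Qed.

Lemma nbr_degree x : exists2 N : {fset V}, N =i adj x & #|` N| = d.+1.
Proof. by have [_ _ _ _] := tree. Qed.

Lemma inner_degree_lt S x y : adj x y -> y \notin S ->
  (inner_degree S x < d.+1)%N.
Proof.
move=> xy yS; have [N Nx <-] := nbr_degree x; apply: fproper_ltn_card.
rewrite fproperEneq; apply/andP; split.
  apply/eqP => /fsetP /(_ y); rewrite !inE (negPf yS) Nx /=.
  by rewrite [_ \in _]xy.
by apply/fsubsetP => z; rewrite !inE Nx => /andP[].
Qed.

Lemma inner_degree_full S x : (forall y, adj x y -> y \in S) ->
  inner_degree S x = d.+1.
Proof.
move=> nS; have [N Nx <-] := nbr_degree x; congr (#|` _|); apply/fsetP => y.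
rewrite !inE Nx; apply/andP/idP => [[]//|xy]; split=> //; exact: nS.
Qed.

Section Leaf.
Variables (S : {fset V}) (x y : V).
Hypotheses (tS : subtree adj S) (xS : x \in S) (yS : y \notin S) (xy : adj x y).

Let only_nbr z : z \in S -> adj z y -> z = x.
Proof.
have [_ _ _ acyclic _] := tree.
by move=> zS zy; apply: (subtree_unique_nbr adj_sym acyclic tS zS xS yS).
Qed.

Let degree_leaf : inner_degree (y |` S) y = 1%N.
Proof.
rewrite /inner_degree (_ : [fset _ | _ in _] = [fset x]) ?cardfs1//.
apply/fsetP => z; rewrite !inE; apply/andP/eqP => [[/predU1P[->|zS]]|->].
- by rewrite adj_irr.
- by rewrite adj_sym => /(only_nbr zS).
- by rewrite xS orbT adj_sym xy.
Qed.

Let degree_parent : inner_degree (y |` S) x = (inner_degree S x).+1.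
Proof.
rewrite /inner_degree (_ : [fset _ | _ in _] = y |` [fset z in S | adj x z]).
  by rewrite cardfsU1 !inE (negPf yS).
apply/fsetP => z; rewrite !inE; case: eqP => [->|_] //=.
Qed.

Let degree_other z : z \in S -> z != x -> inner_degree (y |` S) z = inner_degree S z.
Proof.
move=> zS zx; congr (#|` _|); apply/fsetP => v; rewrite !inE.
case: eqP => [->|_] //=; rewrite (negPf yS)/=; apply: contraNF zx => zy.
exact/eqP/only_nbr.
Qed.

Let edge_leaf : [fset x; y] \notin inner_edges S.
Proof.
apply/in_inner_edges => -[/fsubsetP/(_ y)].
by rewrite !inE eqxx orbT (negPf yS) => /(_ isT).
Qed.

Let inner_edges_leaf : inner_edges (y |` S) = [fset x; y] |` inner_edges S.
Proof.
apply/fsetP => e; rewrite in_fset1U; apply/in_inner_edges/predU1P.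
  move=> [eS [[a b] /= ab eE]]; subst e.
  have bS : b \in y |` S by apply: (fsubsetP eS); rewrite !inE eqxx orbT.
  have aS : a \in y |` S by apply: (fsubsetP eS); rewrite !inE eqxx.
  move: aS bS; rewrite !in_fset1U => /predU1P[aE|aS] /predU1P[bE|bS].
  - by move: ab; rewrite aE bE adj_irr.
  - left; rewrite aE (only_nbr bS) 1?adj_sym -?aE//.
    by apply/fsetP => z; rewrite !inE orbC.
  - by left; rewrite bE (only_nbr aS)// -bE.
  - right; apply/in_inner_edges; split; last by exists (a, b).
    by apply/fsubsetP => z; rewrite !inE => /orP[] /eqP->.
case=> [->|/in_inner_edges[eS eE]]; split=> //.
- by apply/fsubsetP => z; rewrite !inE => /orP[] /eqP->; rewrite ?eqxx ?xS ?orbT.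
- by exists (x, y).
- by rewrite (fsubset_trans eS)// fsubsetU1.
Qed.

(** A leaf [y] attached to [x] uses up one of the factors [u (w x)] and brings
    its own [d] factors [u (w y)]. *)
Lemma tree_weight_leaf w :
  tree_weight (y |` S) w * u (w x) =
  tree_weight S w * (Q (w x - w y) * u (w y) ^+ d).
Proof.
have xNy : x != y by apply: contraTneq xS => ->.
rewrite /tree_weight inner_edges_leaf !big_fsetU1//= edge_weightE// degree_leaf.
rewrite subn1/= [X in _ * X * _ * _](big_fsetD1 x)//= degree_parent.
rewrite [X in _ = X * _ * _](big_fsetD1 x)//=.
rewrite -(subnSK (inner_degree_lt xy yS)) exprS.
rewrite [X in _ * (_ * X) * _ * _](_ : _ =
    \prod_(z <- S `\ x) u (w z) ^+ (d.+1 - inner_degree S z)); first by ring.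
by apply: eq_big_seq => z; rewrite !inE => /andP[zx zS]; rewrite degree_other.
Qed.

End Leaf.

(** Summing over the spin of the leaf reproduces the lost factor [u (w x)]:
    this is the equation of the boundary law. *)
Lemma tree_weight_marginal S x y w : subtree adj S -> x \in S -> y \notin S ->
  adj x y -> \sum_a tree_weight (y |` S) (update w y a) = c * tree_weight S w.
Proof.
move=> tS xS yS xy; have xNy : x != y by apply: contraTneq xS => ->.
have ux0 : u (w x) != 0 by rewrite gt_eqF.
apply: (mulIf ux0); rewrite mulrAC -u_law !mulr_suml.
apply: eq_bigr => a _; rewrite [RHS]mulrC.
have := tree_weight_leaf tS xS yS xy (update w y a).
have -> : update w y a x = w x by rewrite /update (negPf xNy).
have -> : update w y a y = a by rewrite /update eqxx.
move=> ->; congr (_ * _).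
apply: eq_tree_weight => z zS; rewrite /update ifN//.
by apply: contraTneq zS => ->.
Qed.

Lemma tree_weight1 x w : tree_weight [fset x] w = u (w x) ^+ d.+1.
Proof.
rewrite /tree_weight big_seq_fset1 [X in _ * X]big1_seq ?mulr1.
  rewrite (_ : inner_degree _ _ = 0%N) ?subn0//; apply/eqP.
  rewrite cardfs_eq0; apply/eqP/fsetP => y; rewrite !inE.
  by apply/negP => /andP[/eqP->]; rewrite adj_irr.
move=> e /andP[_ /in_inner_edges[ex [[a b] /= ab eE]]]; subst e.
have := fsubsetP ex a; have := fsubsetP ex b; rewrite !inE !eqxx orbT.
by move=> /(_ isT)/eqP bE /(_ isT)/eqP aE; move: ab; rewrite aE bE adj_irr.
Qed.

(** If all neighbours of [L] lie in [S], then on [L] the exponents of [u]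
    vanish and only the energy of [L] depends on the spins in [L]. *)
Lemma tree_weight_split L S : L `<=` S ->
  (forall x y, x \in L -> adj x y -> y \in S) ->
  exists rest : config V q -> R, [/\ forall w, 0 < rest w,
    forall w w', {in S `\` L, w =1 w'} -> rest w = rest w' &
    forall w, tree_weight S w = boltzmann_weight adj Q L w * rest w].
Proof.
move=> LS LN.
exists (fun w => (\prod_(x <- S `\` L) u (w x) ^+ (d.+1 - inner_degree S x)) *
  \prod_(e <- inner_edges S | e `&` L == fset0) edge_weight Q w e); split.
- move=> w; rewrite mulr_gt0// prodr_gt0// => [x _|e _]; first exact: exprn_gt0.
  exact: edge_weight_gt0.
- move=> w w' ww'; congr (_ * _); first by apply: eq_big_seq => x /ww' ->.
  rewrite big_seq_cond [RHS]big_seq_cond.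
  apply: eq_bigr => e /andP[/in_inner_edges[/fsubsetP eS _] eL].
  apply: eq_edge_weight => x xe; apply: ww'; rewrite inE (eS _ xe) andbT.
  apply: contraTN eL => xL; apply/fset0Pn; exists x.
  by rewrite inE xe.
move=> w; rewrite /tree_weight.
have -> : boltzmann_weight adj Q L w =
    \prod_(e <- inner_edges S | e `&` L != fset0) edge_weight Q w e.
  rewrite /boltzmann_weight -[RHS]big_filter [RHS]fsbig_seq ?filter_uniq ?fset_uniq//.
  apply: eq_fsbigl; apply/seteqP; split => e /=.
    move=> [eE eL]; rewrite mem_filter eL/=; apply/in_inner_edges; split=> //.
    have [[a b] /= ab eab] := eE; move: eL; rewrite eab => /fset0Pn[x].
    rewrite !inE => /andP[xab xL]; apply/fsubsetP => z; rewrite !inE.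
    have adjS : forall v, adj x v -> v \in S by move=> v; exact: LN.
    have xS : x \in S by exact: (fsubsetP LS).
    case/orP: xab => /eqP xE /orP[] /eqP->; rewrite -?xE//; apply: adjS.
      by rewrite xE.
    by rewrite xE adj_sym.
  by rewrite mem_filter => /andP[eL /in_inner_edges[_ eE]].
rewrite [X in _ * X = _](bigID (fun e => e `&` L == fset0))/=.
rewrite (big_fsetID _ (mem L))/= [X in X * _ * _]big1_seq => [|x /andP[_]].
  rewrite (_ : [fset _ | _ in _] = S `\` L); first by ring.
  by apply/fsetP => x; rewrite !inE andbC.
rewrite !inE => /andP[_ xL]; rewrite inner_degree_full ?subnn ?expr0//.
by move=> y; exact: LN.
Qed.

End BoundaryWeights.

(** * Kolmogorov extension for sequences *)

(** Lebesgue measure on the right-open interval, which the right-open cells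
    below fill exactly. *)
Definition unit_law (R : realType) : set (measurableTypeR R) -> \bar R :=
  mrestr lebesgue_measure (measurable_itv `[(0:R), 1[).

HB.instance Definition _ (R : realType) := Measure.on (@unit_law R).

Lemma unit_law_setT (R : realType) : @unit_law R setT = 1%E.
Proof.
by rewrite /unit_law/= /mrestr setTI lebesgue_measure_itv/= lte_fin ltr01 oppr0 adde0.
Qed.

HB.instance Definition _ (R : realType) :=
  Measure_isProbability.Build _ _ R (@unit_law R) (@unit_law_setT R).

Section RandomSequence.
Variables (R : realType) (T : finType) (t0 : T) (p : seq T -> R).
Hypothesis p_ge0 : forall s, 0 <= p s.
Hypothesis p_nil : p [::] = 1.
Hypothesis p_cons : forall s, p s = \sum_a p (a :: s).

(** The letters are ordered by [enum_rank]; inside the cell of [s], the cell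
    of [a :: s] starts after those of the letters preceding [a]. *)
Let cumul s k := \sum_(b | (enum_rank b < k)%N) p (b :: s).

Let offset s (a : T) := cumul s (enum_rank a).

Let Fixpoint lo s : R := if s is a :: s' then lo s' + offset s' a else 0.

Let cell s : set R := `[lo s, lo s + p s[.

Let cumul_mono s k l : (k <= l)%N -> cumul s k <= cumul s l.
Proof.
move=> kl; rewrite /cumul big_mkcond [leRHS]big_mkcond/=; apply: ler_sum => b _.
case: ifP => [bk|_]; last by case: ifP.
by rewrite (leq_trans bk kl).
Qed.

Let cumul_last s : cumul s #|T| = p s.
Proof. by rewrite p_cons; apply: eq_bigl => b; rewrite ltn_ord. Qed.

Let cumulS s a : cumul s (enum_rank a).+1 = offset s a + p (a :: s).
Proof.
rewrite addrC /cumul (bigD1 a)//=; congr (_ + _); apply: eq_bigl => b.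
by rewrite ltnS ltn_neqAle andbC -(inj_eq enum_rank_inj).
Qed.

Let offset_le s a : offset s a + p (a :: s) <= p s.
Proof. by rewrite -cumulS -cumul_last; exact: cumul_mono. Qed.

Let offset_ge0 s a : 0 <= offset s a.
Proof. by rewrite sumr_ge0. Qed.

Let offset_mono s a b : (enum_rank a < enum_rank b)%N ->
  offset s a + p (a :: s) <= offset s b.
Proof. by move=> ab; rewrite -cumulS; exact: cumul_mono. Qed.

Let cell_sub s a : cell (a :: s) `<=` cell s.
Proof.
move=> r; rewrite /cell /= !in_itv/= => /andP[h1 h2]; apply/andP; split.
  by apply: le_trans h1; rewrite lerDl.
by apply: lt_le_trans h2 _; rewrite -addrA lerD2l.
Qed.

Let cell_uniq s a b r : cell (a :: s) r -> cell (b :: s) r -> a = b.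
Proof.
rewrite /cell /= !in_itv/= => /andP[a1 a2] /andP[b1 b2].
apply: enum_rank_inj; apply: val_inj => /=.
case: (ltngtP (enum_rank a) (enum_rank b)) => // /(offset_mono s) le.
  have /(lt_le_trans a2) : lo s + offset s a + p (a :: s) <= r.
    by apply: le_trans b1; rewrite -addrA lerD2l.
  by rewrite ltxx.
have /(lt_le_trans b2) : lo s + offset s b + p (b :: s) <= r.
  by apply: le_trans a1; rewrite -addrA lerD2l.
by rewrite ltxx.
Qed.

Let cell_cover s r : cell s r -> exists a, cell (a :: s) r.
Proof.
rewrite /cell /= in_itv/= => /andP[r1 r2].
have ex : exists k, r < lo s + cumul s k by exists #|T|; rewrite cumul_last.
case: (ex_minnP ex) => -[|k] rk kmin.
  move: rk; rewrite /cumul big_pred0 ?addr0; last by move=> b; rewrite ltn0.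
  by rewrite ltNge r1.
have kT : (k < #|T|)%N by apply: kmin; rewrite cumul_last.
exists (enum_val (Ordinal kT)); rewrite /= in_itv/= -addrA -cumulS enum_valK rk.
by rewrite andbT /offset enum_valK/= leNgt; apply/negP => /kmin; rewrite ltnn.
Qed.

Let Fixpoint history n r : seq T := if n is n'.+1 then
  let s := history n' r in odflt t0 [pick a | `[< cell (a :: s) r >]] :: s
  else [::].

Let size_history n r : size (history n r) = n.
Proof. by elim: n => //= n ->. Qed.

Let unit_cell : cell [::] = `[0, 1[%classic.
Proof. by rewrite /cell /= p_nil add0r. Qed.

Let history_cell n r : cell [::] r -> cell (history n r) r.
Proof.
move=> r01; elim: n => //= n IH; case: pickP => [a /asboolP//|none].
have [a ar] := cell_cover IH.
by have /asboolP := none a.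
Qed.

Let history_eq s r : cell s r -> history (size s) r = s.
Proof.
elim: s => //= a s IH ar; rewrite IH; last exact: cell_sub ar.
case: pickP => [b /asboolP br|/(_ a)/asboolP//].
by rewrite (cell_uniq ar br).
Qed.

Let cell_in_unit s : cell s `<=` cell [::].
Proof. by elim: s => // a s IH; apply: subset_trans IH; exact: cell_sub. Qed.

Let history_preimage s :
  [set r | history (size s) r = s] `&` `[0, 1[ = cell s.
Proof.
rewrite -unit_cell; apply/seteqP; split => [r [<- r01]|r rs].
  exact: history_cell.
by split; [exact: history_eq|exact: cell_in_unit rs].
Qed.

Let history_out n r : ~ cell [::] r -> history n r = nseq n t0.
Proof.
move=> r01; elim: n => //= n ->; case: pickP => //= a /asboolP ar.
by case: r01; exact: cell_in_unit ar.
Qed.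

Let measurable_history s : measurable [set r : measurableTypeR R | history (size s) r = s].
Proof.
have -> : [set r | history (size s) r = s] =
    cell s `|` (~` `[0, 1[ `&` [set _ | nseq (size s) t0 = s]).
  rewrite -history_preimage -unit_cell; apply/seteqP; split => r /=.
    by move=> rs; have [r01|r01] := pselect (cell [::] r);
      [left|right; rewrite -(history_out _ r01)].
  by case=> [[]//|[r01 <-]]; rewrite history_out ?size_nseq.
apply: measurableU; first exact: measurable_itv.
apply: measurableI; first by apply: measurableC; exact: measurable_itv.
by have [e|e] := pselect (nseq (size s) t0 = s);
  [rewrite (_ : [set _ | _] = setT)|rewrite (_ : [set _ | _] = set0)];
  rewrite // -subset0 || (apply/seteqP; split).
Qed.

Let history_nth n i r : (i < n)%N ->
  head t0 (history i.+1 r) = nth t0 (rev (history n r)) i.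
Proof.
elim: n => // n IH; rewrite ltnS leq_eqVlt => /predU1P[->|ilt].
  by rewrite [history n.+1 r]/= rev_cons nth_rcons size_rev size_history ltnn eqxx.
by rewrite [history n.+1 r]/= rev_cons nth_rcons size_rev size_history ilt IH.
Qed.

(** Kolmogorov extension for sequences of letters: [0, 1[ is cut into
    consecutive cells of lengths [p [:: a]], each of these is cut in turn, and
    so on; the [n]-th letter of a uniform point of [0, 1[ is read off the
    [n]-th subdivision.  Words are written with the latest letter first. *)
Lemma random_sequence : exists X : nat -> measurableTypeR R -> T,
  (forall n a, measurable [set r | X n r = a]) /\
  forall s, unit_law [set r | forall i, (i < size s)%N ->
                              X i r = nth t0 (rev s) i] = (p s)%:E.
Proof.
exists (fun n r => head t0 (history n.+1 r)); split.
  move=> n a; have -> : [set r | head t0 (history n.+1 r) = a] =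
      \bigcup_(t in [set: n.-tuple T])
        [set r | history (size (a :: t)) r = a :: t].
    apply/seteqP; split => [r /= ra|r [t _]]; last first.
      by rewrite /= size_tuple => -[].
    have sn : size (history n r) == n by rewrite size_history.
    by exists (Tuple sn) => //=; rewrite size_history -ra.
  by apply: fin_bigcup_measurable => // t _; exact: measurable_history.
move=> s; have -> : [set r | forall i, (i < size s)%N ->
    head t0 (history i.+1 r) = nth t0 (rev s) i] =
    [set r | history (size s) r = s].
  apply/seteqP; split => r /= => [sr|rs i si]; last first.
    by have := history_nth r si; rewrite rs.
  apply: (can_inj revK); apply: (@eq_from_nth _ t0).
    by rewrite !size_rev size_history.
  by move=> i; rewrite size_rev size_history => si; rewrite -history_nth//; exact: sr.
rewrite /unit_law /= /mrestr history_preimage lebesgue_measure_itv/= lte_fin ltrDl.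
case: ltP => [_|ps]; first by rewrite -EFinD addrC addKr.
by congr EFin; apply/eqP; rewrite eq_le p_ge0.
Qed.

End RandomSequence.

(** * Measures on configurations *)

Lemma measure_finType_bigcup d (T : measurableType d) (R : realType)
    (mu : {measure set T -> \bar R}) (I : finType) (F : I -> set T) :
  (forall i, measurable (F i)) -> (forall i j x, F i x -> F j x -> i = j) ->
  mu (\bigcup_i F i) = (\sum_i mu (F i))%E.
Proof.
move=> mF tF; rewrite measure_fin_bigcup//.
- rewrite [RHS]fsbig_seq ?index_enum_uniq//; apply: eq_fsbigl.
  by apply/seteqP; split => // i _ /=; rewrite mem_index_enum.
- exact: finite_finset.
- by move=> i j _ _ [x [Fi Fj]]; exact: tF Fi Fj.
Qed.

Lemma pushforward_probability d d' (T : measurableType d)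
    (T' : measurableType d') (R : realType) (P : probability T R) (f : T -> T') :
  measurable_fun setT f ->
  exists P' : probability T' R, forall A, P' A = pushforward P f A.
Proof.
move=> mf; pose X : {mfun T >-> T'} := HB.pack f (isMeasurableFun.Build _ _ _ _ f mf).
by exists (distribution P X).
Qed.

Section Configurations.
Variables (V : choiceType) (q : nat).
Implicit Types (S : {fset V}) (w : config V q).

Definition cyl S w : set (config V q) :=
  [set s : config V q | {in S, s =1 w}].

Lemma measurable_coordinate x (a : 'Z_q) :
  measurable [set s : config V q | s x = a].
Proof. by apply: sub_sigma_algebra; exists x, a. Qed.

Lemma measurable_cyl S w : measurable (cyl S w).
Proof.
rewrite -[cyl S w]setCK; apply: measurableC.
have -> : ~` cyl S w = \bigcup_(x in [set` S]) ~` [set s | s x = w x].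
  apply/seteqP; split => s /=.
    move=> ns; apply: contrapT => none; apply: ns => x xS.
    by apply: contrapT => sx; apply: none; exists x.
  by move=> [x xS sx] /(_ x xS).
apply: fin_bigcup_measurable => [|x _]; first exact: finite_fset.
by apply: measurableC; exact: measurable_coordinate.
Qed.

Lemma measurable_fun_config d (T : measurableType d) (f : T -> config V q) :
  (forall x a, measurable [set t | f t x = a]) -> measurable_fun setT f.
Proof.
move=> mf; apply: (@measurability _ _ _ (config V q) setT f (@cylinders V q)) => //.
by move=> _ [_ [x [a ->]] <-]; rewrite setTI; exact: mf.
Qed.

Definition extension S (g : {ffun S -> 'Z_q}) : config V q :=
  fun x => if insub x is Some v then g v else 0.

Lemma extension_restrict S w :
  {in S, extension [ffun v : S => w (val v)] =1 w}.
Proof.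
by move=> x xS; rewrite /extension insubT ffunE.
Qed.

(** A function of finitely many spins takes finitely many values, each on a
    finite union of cylinders. *)
Lemma measurable_fun_local d (T : measurableType d) (f : config V q -> T) S :
  (forall w w', {in S, w =1 w'} -> f w = f w') -> measurable_fun setT f.
Proof.
move=> flocal _ B mB; rewrite setTI.
have -> : f @^-1` B = \bigcup_(g in [set g : {ffun S -> 'Z_q} | B (f (extension g))])
                        cyl S (extension g).
  apply/seteqP; split => [w Bw|w [g Bg wg]].
    exists [ffun v : S => w (val v)]; last first.
      by move=> x xS; rewrite extension_restrict.
    by rewrite /= (flocal _ w)//; exact: extension_restrict.
  by rewrite /preimage /= (flocal _ _ wg).
by apply: fin_bigcup_measurable => // g _; exact: measurable_cyl.
Qed.

End Configurations.

Section Uniqueness.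
Variables (d q : nat) (V : choiceType) (adj : rel V).
Hypothesis tree : cayley_tree d adj.
Implicit Types (S K : {fset V}) (w : config V q).

Lemma prefix_cover (x : nat -> V) K : (forall v, exists n, x n = v) ->
  exists n, forall m, (n <= m)%N -> (K `<=` prefix x m)%fset.
Proof.
move=> xsurj; have xidx v : exists n, x n == v.
  by have [n /eqP] := xsurj v; exists n.
exists (\max_(v <- K) (xchoose (xidx v)).+1) => m nm.
apply/fsubsetP => v vK; apply/in_prefix; exists (xchoose (xidx v)).
  apply: leq_trans nm; exact: (leq_bigmax_seq (F := fun v => (xchoose (xidx v)).+1)).
by rewrite (eqP (xchooseP (xidx v))).
Qed.

(** The cylinders over the initial segments of an enumeration are pairwise
    nested or disjoint, hence with the empty set they form a pi-system. *)
Lemma config_dynkin (D : set (set (config V q))) K : dynkin D ->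
  (forall S w, subtree adj S -> (K `<=` S)%fset -> D (cyl S w)) ->
  measurable `<=` D.
Proof.
move=> dD cylD.
have [root] := cayley_tree_inhabited tree.
have [x [xinj xsurj xtree]] := subtree_enumeration tree root.
have [n0 n0K] := prefix_cover K xsurj.
pose G : set (set (config V q)) := [set A | A = set0 \/
  exists n w, (n0 <= n)%N /\ A = cyl (prefix x n.+1) w].
have prefix_mono m n : (m <= n)%N -> (prefix x m `<=` prefix x n)%fset.
  move=> mn; apply/fsubsetP => v /in_prefix[i im ->]; apply/in_prefix.
  by exists i => //; exact: leq_trans mn.
have GI : setI_closed G.
  move=> A B [->|[m [w [mn ->]]]]; first by rewrite set0I; left.
  move=> [->|[n [w' [nn ->]]]]; first by rewrite setI0; left.
  wlog mlen : m n w w' mn nn / (m <= n)%N.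
    move=> H; have [|/ltnW] := leqP m n; first exact: H.
    by rewrite setIC; exact: H.
  have [ww'|ww'] := pselect {in prefix x m.+1, w =1 w'}.
    right; exists n, w'; split=> //; apply/seteqP; split => [s []//|s sw'].
    split=> // v vm; rewrite ww'//; apply: sw'.
    by apply: (fsubsetP (prefix_mono _ _ _)) vm.
  left; rewrite -subset0 => s [sw sw']; apply: ww' => v vm.
  rewrite -sw//; apply: sw'; exact: (fsubsetP (prefix_mono _ _ _)) vm.
have GD : G `<=` D.
  move=> _ [->|[n [w [nn ->]]]].
    by rewrite -setCT; apply: (dynkinC dD); exact: dynkinT.
  by apply: cylD; [exact: xtree|apply: n0K; exact: leqW].
have sGD : <<s G >> `<=` D.
  by rewrite -(setI_closed_g_dynkin_g_sigma_algebra GI); exact: smallest_sub.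
apply: subset_trans sGD; apply: smallest_sub; first exact: smallest_sigma_algebra.
move=> _ [v [a ->]]; have [i <-] := xsurj v.
pose m := maxn n0 i.
have -> : [set s : config V q | s (x i) = a] =
    \bigcup_(g in [set g : {ffun prefix x m.+1 -> 'Z_q} | extension g (x i) = a])
      cyl (prefix x m.+1) (@extension V q (prefix x m.+1) g).
  have xi : x i \in prefix x m.+1.
    by apply/in_prefix; exists i => //; rewrite ltnS leq_maxr.
  apply/seteqP; split => [s /= sa|s [g /= ga ->]//].
  exists [ffun v : prefix x m.+1 => s (val v)].
    by rewrite /= extension_restrict.
  by move=> y yS; rewrite extension_restrict.
have mG (A : set (config V q)) : G A ->
  @measurable _ (g_sigma_algebraType G) A by exact: sub_sigma_algebra.
apply: (@fin_bigcup_measurable _ (g_sigma_algebraType G)) => // g _; apply: mG.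
by right; exists m, (extension g); rewrite leq_maxl.
Qed.

Lemma same_measure_subtree (R : realType) (m1 m2 : probability (config V q) R) :
  (forall S w, subtree adj S -> m1 (cyl S w) = m2 (cyl S w)) ->
  same_measure m1 m2.
Proof.
move=> m12 A mA.
suff /(_ A mA)[] : measurable `<=`
  [set A | measurable A /\ m1 A = m2 A] by [].
apply: (@config_dynkin _ fset0).
- split=> /=.
  + by split=> //; rewrite !probability_setT.
  + by move=> B [mB eB]; split; [exact: measurableC|rewrite !probability_setC// eB].
  + move=> F tF F12; have mF n : measurable (F n) by have [] := F12 n.
    split; first exact: bigcup_measurable.
    rewrite !measure_bigcup//; apply: eq_eseriesr => n _.
    by have [] := F12 n.
- by move=> S w tS _; split; [exact: measurable_cyl|exact: m12].
Qed.

End Uniqueness.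

(** * The Gibbs measure of a boundary law *)

Section TreeMeasure.
Variables (R : realType) (d q : nat) (V : choiceType) (adj : rel V).
Variables (Q u : 'Z_q -> R) (c : R).
Hypothesis tree : cayley_tree d adj.
Hypothesis Qeven : forall j : 'Z_q, Q (- j) = Q j.
Hypothesis Qpos : forall j, 0 < Q j.
Hypothesis upos : forall j, 0 < u j.
Hypothesis u_law : forall i : 'Z_q, \sum_j Q (i - j) * u j ^+ d = c * u i.
Implicit Types (S L : {fset V}) (w : config V q).

Let Z := \sum_j u j ^+ d.+1.

(** The weights on a single vertex add up to [Z], and every further leaf
    brings a factor [c]. *)
Definition tree_law S w : R :=
  tree_weight d adj Q u S w / (c ^+ #|` S|.-1 * Z).

Let Z_gt0 : 0 < Z.
Proof.
rewrite /Z (bigD1 0)//= ltr_pwDl ?exprn_gt0// sumr_ge0// => j _.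
by rewrite exprn_ge0 ?ltW.
Qed.

Let c_gt0 : 0 < c.
Proof.
rewrite -(pmulr_lgt0 _ (upos 0)) -u_law (bigD1 0)//= ltr_pwDl//.
  by rewrite mulr_gt0 ?exprn_gt0.
by rewrite sumr_ge0// => j _; rewrite mulr_ge0 ?exprn_ge0 ?ltW.
Qed.

Lemma tree_law_gt0 S w : 0 < tree_law S w.
Proof. by rewrite divr_gt0 ?tree_weight_gt0// mulr_gt0// exprn_gt0. Qed.

Lemma eq_tree_law S w w' : {in S, w =1 w'} -> tree_law S w = tree_law S w'.
Proof. by move=> ww'; rewrite /tree_law (eq_tree_weight _ _ _ _ ww'). Qed.

Lemma tree_law1 x w : tree_law [fset x]%fset w = u (w x) ^+ d.+1 / Z.
Proof. by rewrite /tree_law tree_weight1// cardfs1 mul1r. Qed.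

Lemma tree_law_marginal S x y w : subtree adj S -> x \in S -> y \notin S ->
  adj x y -> \sum_a tree_law (y |` S)%fset (update w y a) = tree_law S w.
Proof.
move=> tS xS yS xy; rewrite /tree_law -mulr_suml.
rewrite (tree_weight_marginal tree Qeven upos u_law _ tS xS yS xy) cardfsU1 yS.
have : (0 < #|` S|)%N by rewrite cardfs_gt0; apply/fset0Pn; exists x.
case: #|` S| => // n _; rewrite add1n /= exprS; field.
by rewrite !gt_eqF ?exprn_gt0.
Qed.

Lemma cyl_split S y w : y \notin S ->
  cyl S w = \bigcup_a cyl (y |` S)%fset (update w y a).
Proof.
move=> yS; apply/seteqP; split => [s sw|s [a _ sw] v vS].
  exists (s y) => // v; rewrite !inE /update; case: eqP => [->//|_ /=].
  exact: sw.
rewrite sw ?inE ?vS ?orbT// /update ifN//.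
by apply: contraNneq yS => <-.
Qed.

(** The measure is built along an enumeration of the tree; its values on the
    cylinders over arbitrary subtrees follow by summing out leaves. *)
Lemma tree_measure : exists mu : probability (config V q) R,
  forall S w, subtree adj S -> mu (cyl S w) = (tree_law S w)%:E.
Proof.
have [[adj_sym _] _ _ _ _] := tree.
have [root] := cayley_tree_inhabited tree.
have [x [xinj xsurj xtree]] := subtree_enumeration tree root.
pose idx v := sval (cid (xsurj v)).
have idxK v : x (idx v) = v by rewrite /idx; case: cid.
have xK i : idx (x i) = i by apply: xinj; rewrite idxK.
pose word (s : seq 'Z_q) : config V q := fun v => nth 0 (rev s) (idx v).
pose p (s : seq 'Z_q) :=
  if s is [::] then 1 else tree_law (prefix x (size s)) (word s).
have xnew n : x n \notin prefix x n.
  by apply/in_prefix => -[i lt /xinj ni]; rewrite ni ltnn in lt.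
have parent n : exists2 z, z \in prefix x n.+1 & adj z (x n.+1).
  have [||z [y [zS + yS zy]]] := subtree_grow adj_sym (xtree n) (xtree n.+1).
  - exact: fsubsetU1.
  - by apply: contraNneq (xnew n.+1) => ->; rewrite !inE eqxx.
  rewrite [prefix x n.+2]/= in_fset1U (negPf yS) orbF => /eqP yx.
  by exists z; rewrite // -yx.
have p_ge0 s : 0 <= p s.
  by case: s => // a s; rewrite ltW// tree_law_gt0.
have p_cons s : p s = \sum_a p (a :: s).
  case: s => [|b s].
    transitivity (\sum_a u a ^+ d.+1 / Z).
      by rewrite -mulr_suml divff// gt_eqF.
    apply: eq_bigr => a _; rewrite /p /= fsetU0 tree_law1.
    by rewrite /word xK.
  have [z zS zx] := parent (size s).
  rewrite [LHS]/p /= -(tree_law_marginal _ (xtree _) zS (xnew _) zx).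
  apply: eq_bigr => a _; apply: (@eq_tree_law (prefix x (size s).+2)) => v.
  move=> /in_prefix[i ilt ->]; rewrite /update /word xK [in RHS]rev_cons.
  rewrite nth_rcons size_rev (inj_eq xinj) /=.
  move: ilt; rewrite ltnS leq_eqVlt => /predU1P[->|ilt]; first by rewrite eqxx ltnn.
  by rewrite ilt ltn_eqF.
have [X [mX Xp]] := random_sequence 0 p_ge0 erefl p_cons.
pose Phi r : config V q := fun v => X (idx v) r.
have mPhi : measurable_fun setT Phi.
  by apply: measurable_fun_config => v a; exact: mX.
have [mu muE] := pushforward_probability (@unit_law R) mPhi.
have mu_prefix n w : mu (cyl (prefix x n.+1) w) = (tree_law (prefix x n.+1) w)%:E.
  rewrite muE /pushforward.
  pose s := rev (mkseq (w \o x) n.+1).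
  have ss : size s = n.+1 by rewrite size_rev size_mkseq.
  have -> : Phi @^-1` cyl (prefix x n.+1) w =
      [set r | forall i, (i < size s)%N -> X i r = nth 0 (rev s) i].
    rewrite ss revK; apply/seteqP; split => r /= rP.
      move=> i ilt; rewrite nth_mkseq//= -(rP (x i)) ?/Phi ?xK//.
      by apply: (introT (in_prefix x n.+1 _)); exists i.
    move=> v /(in_prefix x n.+1)[i ilt ->]; rewrite /Phi xK rP// nth_mkseq//.
  apply: etrans (Xp s) _; congr EFin.
  have -> : p s = tree_law (prefix x (size s)) (word s).
    by move: ss; case: (s).
  rewrite ss; apply: eq_tree_law => v /in_prefix[i ilt ->].
  by rewrite /word revK xK nth_mkseq.
exists mu => S w tS.
have [n /(_ n.+1 (leqnSn n))] := prefix_cover S xsurj.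
move kE : #|` prefix x n.+1 `\` S|%fset => k.
elim: k S w tS kE => [|k IH] S w tS kE Sn.
  move/eqP: kE; rewrite cardfs_eq0 fsetD_eq0 => nS.
  have -> : S = prefix x n.+1 by apply/eqP; rewrite eqEfsubset Sn nS.
  exact: mu_prefix.
have neq : S != prefix x n.+1.
  by apply/eqP => SE; move: kE; rewrite -SE fsetDv cardfs0.
have [z [y [zS yn yS zy]]] := subtree_grow adj_sym tS (xtree n) Sn neq.
rewrite (cyl_split w yS) measure_finType_bigcup.
- rewrite -(tree_law_marginal _ tS zS yS zy) -sumEFin/=; apply: eq_bigr => a _.
  apply: IH.
  + exact: subtreeU zy.
  + apply/eqP; rewrite -eqSS -kE (cardfsD1 y (_ `\` S)%fset) in_fsetD yS yn.
    by rewrite add1n eqSS fsetDDl fsetUC.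
  + by rewrite fsubUset fsub1set yn.
- by move=> a; exact: measurable_cyl.
- move=> a b s /(_ y) sa /(_ y) sb.
  by move: sa sb; rewrite !inE eqxx /= /update eqxx => /(_ isT) <- /(_ isT).
Qed.

Section Kernel.
Variables (L K : {fset V}).
Hypothesis LK : (L `<=` K)%fset.
Hypothesis NK : forall x y, x \in L -> adj x y -> y \in K.

Local Notation B := (boltzmann_weight adj Q L).
Local Notation glue s w := (glue_config (s : {ffun L -> 'Z_q}) w).

Let B_split S : (K `<=` S)%fset -> exists rest : config V q -> R,
  [/\ forall w, 0 < rest w,
    forall w w', {in (S `\` L)%fset, w =1 w'} -> rest w = rest w' &
    forall w, tree_weight d adj Q u S w = B w * rest w].
Proof.
move=> KS; apply: tree_weight_split => //; first exact: fsubset_trans KS.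
by move=> x y xL xy; apply: (fsubsetP KS); exact: NK xy.
Qed.

Let B_gt0 w : 0 < B w.
Proof.
have [rest [r0 _ rE]] := B_split (fsubset_refl K).
by rewrite -(pmulr_lgt0 _ (r0 w)) -rE; exact: tree_weight_gt0.
Qed.

Let eq_B w w' : {in K, w =1 w'} -> B w = B w'.
Proof.
move=> ww'; have [rest [r0 rl rE]] := B_split (fsubset_refl K).
apply: (mulIf (lt0r_neq0 (r0 w))); rewrite -rE [in RHS](rl w w').
  by rewrite -rE; exact: eq_tree_weight.
by move=> v; rewrite inE => /andP[_]; exact: ww'.
Qed.

Let glue_in s w v (vL : v \in L) : glue s w v = s [` vL]%fset.
Proof. by rewrite /glue_config insubT. Qed.

Let glue_val s w (v : L) : glue s w (val v) = s v.
Proof. by rewrite /glue_config valK. Qed.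

Let glue_out s w v : v \notin L -> glue s w v = w v.
Proof. by move=> vL; rewrite /glue_config insubN. Qed.

Let eq_glue S s w w' : {in (S `\` L)%fset, w =1 w'} ->
  {in S, glue s w =1 glue s w'}.
Proof.
move=> ww' v vS; have [vL|vL] := boolP (v \in L); first by rewrite !glue_in.
by rewrite !glue_out// ww'// inE vL.
Qed.

Let weight s w := (partition_function adj Q L w)^-1 * B (glue s w).

Let partition_gt0 w : 0 < partition_function adj Q L w.
Proof.
rewrite /partition_function (bigD1 [ffun v => 0])//= ltr_pwDl//.
by apply: sumr_ge0 => s _; exact: ltW.
Qed.

Let eq_partition w w' : {in (K `\` L)%fset, w =1 w'} ->
  partition_function adj Q L w = partition_function adj Q L w'.
Proof.
by move=> ww'; apply: eq_bigr => s _; apply: eq_B; exact: eq_glue.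
Qed.

Let weight_ge0 s w : 0 <= weight s w.
Proof. by rewrite mulr_ge0 ?invr_ge0 ?ltW. Qed.

Let weight_sum w : \sum_s weight s w = 1.
Proof. by rewrite -mulr_sumr mulVf ?gt_eqF. Qed.

Let measurable_weight s : measurable_fun setT (weight s).
Proof.
apply: (@measurable_fun_local _ _ _ _ _ K) => w w' ww'.
have {}ww' : {in (K `\` L)%fset, w =1 w'}.
  by move=> v; rewrite inE => /andP[_]; exact: ww'.
rewrite /weight (eq_partition ww'); congr (_ * _).
by apply: eq_B; exact: eq_glue.
Qed.

Let measurable_glue s : measurable_fun setT (fun w : config V q => glue s w).
Proof.
apply: measurable_fun_config => x a.
have [xL|xL] := boolP (x \in L).
  have [sa|sa] := pselect (s [` xL]%fset = a).
    rewrite (_ : [set _ | _] = setT)//; apply/seteqP; split => // w _ /=.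
    by rewrite glue_in.
  rewrite (_ : [set _ | _] = set0)// -subset0 => w /=.
  by rewrite glue_in.
rewrite (_ : [set _ | _] = [set w : config V q | w x = a]).
  exact: measurable_coordinate.
by apply/seteqP; split => w /=; rewrite glue_out.
Qed.

Local Notation kernel w A := (gibbs_kernel adj Q L w A).

Let kernel_ge0 w A : 0 <= kernel w A.
Proof.
by apply: sumr_ge0 => s _; rewrite mulr_ge0 ?indicE ?ler0n//; exact: weight_ge0.
Qed.

Let measurable_kernel A : measurable A ->
  measurable_fun setT (fun w : config V q => (kernel w A)%:E).
Proof.
move=> mA; apply/measurable_EFinP; apply: measurable_sum => s.
apply: measurable_funM; first exact: measurable_weight.
by apply: measurableT_comp (measurable_glue s); exact: measurable_indic.
Qed.

Let kernelT w : kernel w setT = 1.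
Proof. by rewrite -(weight_sum w); apply: eq_bigr => s _; rewrite indicT mulr1. Qed.

Let kernelC w A : kernel w A + kernel w (~` A) = 1.
Proof.
rewrite -(weight_sum w) -big_split/=; apply: eq_bigr => s _.
by rewrite -mulrDr !indicE in_setC; case: (_ \in A); rewrite /= ?addr0 ?add0r mulr1.
Qed.

Let kernel_bigcup w (F : (set (config V q))^nat) :
  (forall n, measurable (F n)) -> trivIset setT F ->
  (kernel w (\bigcup_n F n))%:E = (\sum_(n <oo) (kernel w (F n))%:E)%E.
Proof.
move=> mF tF.
have kE A : (kernel w A)%:E = (\sum_s (weight s w)%:E * \d_(glue s w) A)%E.
  rewrite -sumEFin; apply: eq_bigr => s _.
  by rewrite EFinM diracE indicE.
rewrite kE; under eq_eseriesr do rewrite kE.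
rewrite nneseries_sum => [|s n _]; last by rewrite mule_ge0// lee_fin.
apply: eq_bigr => s _; rewrite nneseriesZl => [|n _]; last exact: measure_ge0.
rewrite measure_semi_bigcup//; exact: bigcup_measurable.
Qed.

Variable mu : probability (config V q) R.
Hypothesis muP : forall S w, subtree adj S -> mu (cyl S w) = (tree_law S w)%:E.

Section Cylinder.
Variables (S : {fset V}) (w0 : config V q).
Hypotheses (tS : subtree adj S) (KS : (K `<=` S)%fset).

Let s0 : {ffun L -> 'Z_q} := [ffun v : L => w0 (val v)].

Let glue_cyl s w : cyl S w0 (glue s w) <-> s = s0 /\ cyl (S `\` L)%fset w0 w.
Proof.
split=> [sw|[-> sw] v vS].
  split=> [|v].
    apply/ffunP => v; rewrite ffunE -sw; last first.
      by apply: (fsubsetP KS); apply: (fsubsetP LK); exact: fsvalP.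
    by rewrite glue_val.
  by rewrite inE => /andP[vL vS]; rewrite -sw// glue_out.
have [vL|vL] := boolP (v \in L); first by rewrite glue_in ffunE.
by rewrite glue_out// sw// inE vL.
Qed.

Let kernel_cyl w : kernel w (cyl S w0) =
  (partition_function adj Q L w0)^-1 * B w0 * \1_(cyl (S `\` L)%fset w0) w.
Proof.
have [sw|sw] := pselect (cyl (S `\` L)%fset w0 w); last first.
  rewrite indicE memNset// mulr0; apply: big1 => s _.
  by rewrite indicE memNset ?mulr0// => /glue_cyl[].
rewrite indicE mem_set// mulr1 /gibbs_kernel (bigD1 s0)//= big1 => [|s ss0].
  have gc : cyl S w0 (glue s0 w) by exact/glue_cyl.
  rewrite addr0 indicE mem_set// mulr1 (@eq_partition _ w0).
    congr (_ * _); apply: eq_B => v vK; apply: gc; exact: (fsubsetP KS).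
  by move=> v; rewrite inE => /andP[vL vK]; apply: sw; rewrite inE vL (fsubsetP KS).
by rewrite indicE memNset ?mulr0// => /glue_cyl[/eqP]; rewrite (negPf ss0).
Qed.

Let cyl_glue : cyl (S `\` L)%fset w0 = \bigcup_s cyl S (glue s w0).
Proof.
apply/seteqP; split => [w sw|w [s _ sw] v]; last first.
  by rewrite inE => /andP[vL vS]; rewrite sw// glue_out.
exists [ffun v : L => w (val v)] => // v vS.
have [vL|vL] := boolP (v \in L); first by rewrite glue_in ffunE.
by rewrite glue_out// sw// inE vL.
Qed.

(** The tree weight of [S] is the Boltzmann weight of [L] times a factor that
    ignores the spins in [L].  The configuration off [L] has the law obtained
    by summing the tree weight over the spins in [L], that is, the partition
    function times that factor; the partition function cancels. *)
Lemma gibbs_cylinder : (\int[mu]_w (kernel w (cyl S w0))%:E = mu (cyl S w0))%E.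
Proof.
under eq_integral do rewrite kernel_cyl EFinM.
rewrite ge0_integralZl_EFin//; last 2 first.
- by apply/measurable_EFinP; apply: measurable_indic; exact: measurable_cyl.
- by rewrite mulr_ge0 ?invr_ge0 ?ltW.
rewrite integral_indic ?setIT//; last exact: measurable_cyl.
rewrite cyl_glue measure_finType_bigcup; last 2 first.
- by move=> s; exact: measurable_cyl.
- move=> s s' w sw sw'; apply/ffunP => v.
  have vS : val v \in S.
    by apply: (fsubsetP KS); apply: (fsubsetP LK); exact: fsvalP.
  by have := sw _ vS; rewrite sw'// !glue_val => /esym.
rewrite (eq_bigr (fun s => (tree_law S (glue s w0))%:E)) => [|s _]; last first.
  exact: muP.
rewrite sumEFin -EFinM; apply: etrans (esym (muP _ tS)); congr EFin.
have [rest [r0 rl rE]] := B_split KS.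
rewrite /tree_law -mulr_suml.
rewrite (eq_bigr (fun s => B (glue s w0) * rest w0)) => [|s _]; last first.
  rewrite rE; congr (_ * _); apply: rl => v; rewrite inE => /andP[vL _].
  by rewrite glue_out.
rewrite -mulr_suml rE -/(partition_function adj Q L w0); field.
by rewrite !gt_eqF ?exprn_gt0.
Qed.

End Cylinder.

(** Both sides are additive in [A], so that cylinders over large subtrees
    suffice. *)
Lemma gibbs_kernel_invariant A : measurable A ->
  (\int[mu]_w (kernel w A)%:E = mu A)%E.
Proof.
move=> mA; suff /(_ A mA)[] : measurable `<=`
  [set A | measurable A /\ (\int[mu]_w (kernel w A)%:E = mu A)%E] by [].
apply: (@config_dynkin _ _ _ _ tree _ K); last first.
  by move=> S w0 tS KS; split; [exact: measurable_cyl|exact: gibbs_cylinder].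
split=> /=.
- split=> //; under eq_integral do rewrite kernelT.
  by rewrite integral_cst//= mul1e.
- move=> B [mB eB]; split; first exact: measurableC.
  have : (\int[mu]_w ((kernel w B)%:E + (kernel w (~` B))%:E) = 1)%E.
    under eq_integral do rewrite -EFinD kernelC.
    by rewrite integral_cst//= mul1e probability_setT.
  rewrite ge0_integralD//=; first last.
  - by apply: measurable_kernel; exact: measurableC.
  - by move=> w _; rewrite lee_fin.
  - exact: measurable_kernel.
  - by move=> w _; rewrite lee_fin.
  rewrite eB probability_setC// => <-.
  by rewrite addeAC subee ?add0e// fin_num_measure.
- move=> F tF F12; have mF n : measurable (F n) by have [] := F12 n.
  split; first exact: bigcup_measurable.
  under eq_integral do rewrite kernel_bigcup//.
  rewrite integral_nneseries//; last 2 first.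
  - by move=> n; exact: measurable_kernel.
  - by move=> n w _; rewrite lee_fin.
  rewrite measure_semi_bigcup//; last exact: bigcup_measurable.
  by apply: eq_eseriesr => n _; have [] := F12 n.
Qed.

End Kernel.

Lemma gibbs_tree_measure (mu : probability (config V q) R) :
  (forall S w, subtree adj S -> mu (cyl S w) = (tree_law S w)%:E) ->
  gibbs_measure adj Q mu.
Proof.
move=> muP L A mA.
pose nbrs x := sval (cid2 (nbr_degree tree x)).
pose K := (L `|` \bigcup_(x <- L) nbrs x)%fset.
apply: (@gibbs_kernel_invariant L K) => //; first exact: fsubsetUl.
move=> x y xL xy; rewrite inE; apply/orP; right.
apply/bigfcupP; exists x; first by rewrite xL.
by rewrite /nbrs; case: cid2 => N /= ->.
Qed.

End TreeMeasure.

(** * Symmetries of the Gibbs measures *)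

Section Symmetries.
Variables (R : realType) (d q : nat) (V : choiceType) (adj : rel V).
Variables (Q u : 'Z_q -> R) (c : R).
Hypothesis tree : cayley_tree d adj.
Hypothesis Qeven : forall j : 'Z_q, Q (- j) = Q j.
Implicit Types (S : {fset V}) (w : config V q).

Let adj_irr : irreflexive adj. Proof. by have [[]] := tree. Qed.

Section Automorphism.
Variable phi : V -> V.
Hypothesis phi_inj : injective phi.
Hypothesis phi_adj : forall x y, adj (phi x) (phi y) = adj x y.
Local Open Scope fset_scope.

Let image1 x : phi @` [fset x] = [fset phi x].
Proof.
apply/fsetP => y; apply/imfsetP/fset1P => [[z /= /fset1P -> ->]//|->].
by exists x; rewrite //= inE.
Qed.

Let edges_image e : edges adj e -> edges adj (phi @` e).
Proof.
move=> [[x y] /= xy ->]; exists (phi x, phi y); rewrite /= ?phi_adj//.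
by rewrite imfsetU !image1.
Qed.

Lemma subtree_image S : subtree adj S -> subtree adj (phi @` S).
Proof.
elim=> [x|{}S x y _ IH xS yS xy]; first by rewrite image1; constructor.
rewrite imfsetU image1; apply: (subtreeU (x := phi x)) => //.
- by rewrite mem_imfset.
- by rewrite mem_imfset.
- by rewrite phi_adj.
Qed.

Let inner_degree_image S x : inner_degree adj (phi @` S) (phi x) = inner_degree adj S x.
Proof.
rewrite /inner_degree.
have -> : [fset y in phi @` S | adj (phi x) y] = phi @` [fset y in S | adj x y].
  apply/fsetP => y; rewrite !inE; apply/andP/imfsetP => [[/imfsetP[z zS ->]]|].
    by rewrite phi_adj => xz; exists z; rewrite //= !inE zS.
  by move=> [z]; rewrite /= !inE => /andP[zS xz] ->; rewrite mem_imfset// phi_adj.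
by rewrite card_imfset.
Qed.

Let inner_edges_image S :
  inner_edges adj (phi @` S) = (fun e : {fset V} => phi @` e) @` inner_edges adj S.
Proof.
apply/fsetP => e; apply/in_inner_edges/imfsetP => [[eS [[a b] /= ab eE]]|].
  have : a \in phi @` S by apply: (fsubsetP eS); rewrite eE !inE eqxx.
  have : b \in phi @` S by apply: (fsubsetP eS); rewrite eE !inE eqxx orbT.
  move=> /imfsetP[/= b' b'S bE] /imfsetP[/= a' a'S aE].
  exists [fset a'; b']; last by rewrite imfsetU !image1 -aE -bE.
  apply/in_inner_edges; split; last by exists (a', b'); rewrite //= -phi_adj -aE -bE.
  by apply/fsubsetP => z; rewrite !inE => /orP[] /eqP->.
move=> [e' /= /in_inner_edges[eS eE] ->]; split; last exact: edges_image.
by apply/fsubsetP => _ /imfsetP[z /= ze ->]; rewrite mem_imfset//; exact: (fsubsetP eS).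
Qed.

Lemma tree_law_image S w :
  tree_law d adj Q u c (phi @` S) w = tree_law d adj Q u c S (w \o phi).
Proof.
rewrite /tree_law card_imfset//=; congr (_ / _).
rewrite /tree_weight; congr (_ * _).
  rewrite big_imfset/=; last by move=> x y _ _; exact: phi_inj.
  by apply: eq_bigr => x _; rewrite inner_degree_image.
rewrite inner_edges_image big_imfset/=; last first.
  move=> e e' _ _ ee'; apply/fsetP => x.
  have inE' (f : {fset V}) : (x \in f) = (phi x \in phi @` f).
    by rewrite mem_imfset.
  by rewrite !inE' ee'.
apply: eq_big_seq => e /in_inner_edges[_ [[x y] /= xy ->]].
have xNy : x != y by apply: contraTneq xy => ->; rewrite adj_irr.
rewrite imfsetU !image1 !edge_weightE//.
by rewrite (inj_eq phi_inj).
Qed.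

End Automorphism.

Lemma automorphism_invariant_tree_measure (mu : probability (config V q) R) :
  (forall S w, subtree adj S -> mu (cyl S w) = (tree_law d adj Q u c S w)%:E) ->
  automorphism_invariant adj mu.
Proof.
move=> muP phi [phi_bij phi_adj]; have phi_inj := bij_inj phi_bij.
have [psi phiK psiK] := phi_bij.
have mphi : measurable_fun setT (fun s : config V q => s \o phi : config V q).
  by apply: measurable_fun_config => x a; exact: (measurable_coordinate (phi x)).
have [nu nuE] := pushforward_probability mu mphi.
have : same_measure nu mu.
  apply: (same_measure_subtree tree) => S w tS; rewrite nuE /pushforward.
  rewrite (_ : _ @^-1` _ = cyl (phi @` S)%fset (w \o psi)).
    rewrite !muP//; last exact: subtree_image.
    rewrite tree_law_image//; congr (_%:E); apply: eq_tree_law => x _ /=.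
    by rewrite phiK.
  apply/seteqP; split => [s sw _ /imfsetP[x /= xS ->]|s sw x xS] /=.
    by rewrite phiK -sw.
  by rewrite sw ?mem_imfset//= phiK.
by move=> nm A mA; rewrite -nuE nm.
Qed.

(** The energy depends on differences of spins only, hence translating the
    boundary law translates the configuration. *)
Lemma tree_law_translate k S w :
  tree_law d adj Q (fun a => u (a - k)) c S w =
  tree_law d adj Q u c S (translate (- k) w).
Proof.
rewrite /tree_law; congr (_ / (_ * _)); last first.
  by rewrite [RHS](reindex_inj (addIr (- k))).
congr (_ * _); apply: eq_big_seq => e /in_inner_edges[_ [[x y] /= xy ->]].
have xNy : x != y by apply: contraTneq xy => ->; rewrite adj_irr.
by rewrite !edge_weightE// /translate opprD opprK addrACA addNr addr0.
Qed.

End Symmetries.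

(** * The family of Gibbs measures *)

Theorem mainTheorem6 (R : realType) (d q : nat) (V : choiceType)
    (adj : rel V) (Q : 'Z_q -> R)
    (hd : (2 <= d)%N) (hq : (2 <= q)%N) (htree : cayley_tree d adj)
    (Qpos : forall j : 'Z_q, 0 < Q j) (Qeven : forall j : 'Z_q, Q (- j) = Q j)
    (Q0 : Q 0 = 1) :
  let gamma := lpnorm (d.+1%:R / 2) predT Q in
  let delta := lpnorm d.+1%:R (predC1 0) Q in
  good_set d (gamma, delta) ->
  exists2 eps : R, smallest_positive_solution d gamma delta eps &
  exists mu : 'Z_q -> probability (config V q) R,
  [/\ forall i, gibbs_measure adj Q (mu i),
      forall i, automorphism_invariant adj (mu i),
      forall i j : 'Z_q, i != j -> ~ same_measure (mu i) (mu j),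
      forall i j : 'Z_q, same_measure (mu j) (pushforward (mu i) (translate (j - i)))
    & forall (i : 'Z_q) (x0 : V),
      (((delta * ((1 - delta * eps ^+ d) / (1 + gamma * eps ^+ d.-1)))
          ^+ d.+1)%R%:E
        <= mu i [set s | s x0 != i] / mu i [set s | s x0 = i]
        <= ((delta * ((1 + delta * eps ^+ d) / (1 - gamma * eps ^+ d.-1)))
          ^+ d.+1)%R%:E)%E].
Proof.
case: d hd htree => // m m0 tree gamma delta good.
have [eps eps_sol [eps1 eps_small]] := smallest_solution_exists m0 good.
exists eps => //.
have [[gamma1 delta0 _] [[eps0 epsE] _]] := (good, eps_sol).
rewrite /= in gamma1 delta0.
have gE := lpnorm_half Qpos (ltn0Sn m.+1).
have dE := lpnorm_off0 Qpos (ltn0Sn m.+1).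
rewrite -/gamma in gE; rewrite -/delta in dE.
have ge0 : 0 <= gamma * eps ^+ m by rewrite mulr_ge0 ?exprn_ge0 ?ltW// (lt_trans _ gamma1).
have de0 : 0 <= delta * eps ^+ m.+1 by rewrite mulr_ge0 ?exprn_ge0 ?ltW.
have m1 : 1 <= m.+1%:R :> R by rewrite ler1n.
have [mg md] : m.+1%:R * (gamma * eps ^+ m) >= gamma * eps ^+ m /\
    m.+1%:R * (delta * eps ^+ m.+1) >= delta * eps ^+ m.+1.
  by split; exact: ler_peMl.
rewrite -!mulrA in eps_small.
have contr : m.+1%:R * gamma * eps ^+ m + m.+1%:R * delta * eps ^+ m.+1 < 1.
  by rewrite -!mulrA; lra.
have g1 : gamma * eps ^+ m < 1 by lra.
have d1 : delta * eps ^+ m.+1 < 1 by lra.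
have [u [[upos u0] u_law nu_le nu_ub nu_lb]] :
    exists u : 'Z_q -> R,
    let nu := lnorm m.+2 (fun i => if i == 0 then 0 else u i) in
    [/\ (forall i, 0 < u i) /\ u 0 = 1,
        (forall i, \sum_j Q (i - j) * u j ^+ m.+1 = (\sum_j Q j * u j ^+ m.+1) * u i),
        nu <= eps,
        nu * (1 - gamma * eps ^+ m) <= delta * (1 + delta * eps ^+ m.+1)
      & delta * (1 - delta * eps ^+ m.+1) <= nu * (1 + gamma * eps ^+ m)].
  rewrite gE dE; apply: boundary_law_exists; rewrite -?gE -?dE//.
set nu := lnorm _ _ in nu_le nu_ub nu_lb.
set c := \sum_j _ in u_law.
(* The law of [mu i] concentrates near [i]: its boundary law is [u] moved
   from [0] to [i]. *)
pose v (i a : 'Z_q) := u (a - i).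
have vpos i a : 0 < v i a by exact: upos.
have v_law i a : \sum_j Q (a - j) * v i j ^+ m.+1 = c * v i a.
  rewrite /v -u_law [RHS](reindex_inj (addIr (- i))); apply: eq_bigr => j _.
  by rewrite opprB addrA subrK.
have [mu muP] := choice (fun i => tree_measure tree Qeven Qpos (vpos i) (v_law i)).
pose Z := \sum_j u j ^+ m.+2.
have vZ i : \sum_j v i j ^+ m.+2 = Z.
  by rewrite /Z [RHS](reindex_inj (addIr (- i))).
have mu1 i x a : mu i [set s | s x = a] = (u (a - i) ^+ m.+2 / Z)%:E.
  rewrite (_ : [set s | s x = a] = cyl [fset x]%fset (fun=> a)).
    rewrite muP; last exact: subtree1.
    by rewrite tree_law1// vZ.
  apply/seteqP; split => [s /= sa y|s /(_ x)].
    by rewrite inE => /eqP->.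
  by rewrite inE; apply.
have ZE : Z = 1 + nu ^+ m.+2.
  rewrite /nu lnormX//; last by move=> i; case: ifP => // _; exact: ltW.
  rewrite /Z (bigD1 0)//= u0 expr1n [in RHS](bigD1 0)//= ?eqxx expr0n add0r.
  by congr (_ + _); apply: eq_bigr => j /negPf ->.
have nu0 : 0 <= nu by exact: lnorm_ge0.
have Z0 : 0 < Z by rewrite ZE ltr_pwDl// exprn_ge0.
exists mu; split.
- by move=> i; exact: (gibbs_tree_measure tree Qpos (vpos i) (v_law i) (muP i)).
- by move=> i; exact: (automorphism_invariant_tree_measure tree Qeven (muP i)).
- have [root] := cayley_tree_inhabited tree.
  (* Equality at the spin [i] would force [u (i - j) = u 0 = 1]. *)
  move=> i j ij /(_ _ (measurable_coordinate root i)).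
  rewrite !mu1 subrr u0 expr1n => -[] /eqP.
  rewrite -subr_eq0 -mulrBl mulf_eq0 invr_eq0 (gt_eqF Z0) orbF subr_eq0 eq_sym.
  rewrite lt_eqF// exprn_ilt1 ?ltW// (le_lt_trans _ eps1)// (le_trans _ nu_le)//.
  have := @lnorm_ge R _ m.+2 isT (fun i => if i == 0 then 0 else u i) (i - j).
  by rewrite subr_eq0 (negPf ij); apply => t; case: ifP => // _; exact: ltW.
- move=> i j A mA.
  have mt : measurable_fun setT (@translate V q (j - i)).
    apply: measurable_fun_config => x a.
    rewrite (_ : [set _ | _] = [set s : config V q | s x = a - (j - i)]).
      exact: measurable_coordinate.
    apply/seteqP; split => s /=; rewrite /translate; first by move <-; rewrite addrK.
    by move->; rewrite subrK.
  have [nut nutE] := pushforward_probability (mu i) mt.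
  rewrite -nutE; apply: (same_measure_subtree tree) mA => S w tS.
  rewrite nutE /pushforward.
  rewrite (_ : _ @^-1` _ = cyl S (translate (- (j - i)) w)).
    rewrite !muP// -tree_law_translate//; congr EFin.
    rewrite (_ : (fun a => v i (a - (j - i))) = v j)//.
    by apply/funext => a; rewrite /v -addrA -opprD subrK.
  apply/seteqP; split => s sw x xS; rewrite /translate.
    by rewrite -sw// /translate addrK.
  by rewrite sw// /translate subrK.
- move=> i x0.
  have -> : [set s : config V q | s x0 != i] = ~` [set s | s x0 = i].
    by apply/seteqP; split => s /= /eqP.
  rewrite probability_setC; last exact: measurable_coordinate.
  rewrite mu1 subrr u0 expr1n div1r -EFinB inver gt_eqF ?invr_gt0// -EFinM.
  have -> : (1 - Z^-1) / Z^-1 = nu ^+ m.+2.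
    by rewrite invrK mulrBl mulVf ?gt_eqF// mul1r ZE addrC addKr.
  rewrite !lee_fin /=.
  have g1' : 0 < 1 + gamma * eps ^+ m by rewrite ltr_pwDl.
  apply/andP; split; rewrite lerXn2r ?nnegrE//.
  + by rewrite !mulr_ge0 ?invr_ge0 ?subr_ge0 ?ltW.
  + by rewrite mulrA ler_pdivrMr.
  + by rewrite !mulr_ge0 ?invr_ge0 ?subr_ge0 ?ltW// ltr_pwDl.
  + by rewrite mulrA ler_pdivlMr ?subr_gt0.
Qed.
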